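(* (i) One obtains a hermitian projection $e\in M_{2^n}(C_{\mathrm{alg}}(S^{2n}_\theta))$ (that is, $e=e^2=e^*$) by setting $$e=\tfrac12\Big(\mathbf 1+\sum_{\mu=1}^n(\Gamma^{\mu*}u^\mu+\Gamma^\mu u^{\mu*})+\gamma u\Big).$$ Furthermore one has $\mathrm{ch}_m(e)=0$ for $0\le m\le n-1$. (ii) One obtains a unitary $U\in M_{2^{n-1}}(C_{\mathrm{alg}}(S^{2n-1}_\theta))$ by setting $U=\sum_{\mu=1}^n(\bar\sigma^\mu v^\mu+\sigma^\mu\bar v^\mu)$. Furthermore one has $\mathrm{ch}_{m-\frac12}(U)=0$ for $1\le m\le n-1$.
   Context: Let $n\ge2$ be an integer, $\theta=(\theta_{\mu\nu})\in M_n(\mathbb{R})$ antisymmetric, $\lambda^{\mu\nu}=e^{i\theta_{\mu\nu}}$. No summation over repeated indices unless indicated. $C_{\mathrm{alg}}(\mathbb{R}^{2n}_\theta)$: unital complex $*$-algebra generated by $z^\mu$, $\bar z^\mu=z^{\mu*}$ ($\mu=1,\dots,n$) with relations $z^\mu z^\nu=\lambda^{\mu\nu}z^\nu z^\mu$, $\bar z^\mu\bar z^\nu=\lambda^{\mu\nu}\bar z^\nu\bar z^\mu$, $\bar z^\mu z^\nu=\lambda^{\nu\mu}z^\nu\bar z^\mu$. $C_{\mathrm{alg}}(\mathbb{R}^{2n+1}_\theta)$: obtained by adding a central hermitian generator $x$. $C_{\mathrm{alg}}(S^{2n}_\theta)$: quotient of $C_{\mathrm{alg}}(\mathbb{R}^{2n+1}_\theta)$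 by the ideal generated by $\sum_\mu z^\mu\bar z^\mu+x^2-\mathbf 1$; $u^\mu,u^{\mu*},u$ are the images of $z^\mu,\bar z^\mu,x$. $C_{\mathrm{alg}}(S^{2n-1}_\theta)$: quotient of $C_{\mathrm{alg}}(\mathbb{R}^{2n}_\theta)$ by the ideal generated by $\sum_\mu z^\mu\bar z^\mu-\mathbf 1$; $v^\mu,\bar v^\mu$ are the images of $z^\mu,\bar z^\mu$. $\mathrm{Cliff}(\mathbb{R}^{2n}_\theta)$: unital complex $*$-algebra generated by $\Gamma^\mu,\Gamma^{\mu*}=(\Gamma^\mu)^*$ ($\mu=1,\dots,n$) with relations $\Gamma^\mu\Gamma^\nu+\lambda^{\nu\mu}\Gamma^\nu\Gamma^\mu=0$, $\Gamma^{\mu*}\Gamma^{\nu*}+\lambda^{\nu\mu}\Gamma^{\nu*}\Gamma^{\mu*}=0$, $\Gamma^{\mu*}\Gamma^\nu+\lambda^{\mu\nu}\Gamma^\nu\Gamma^{\mu*}=\delta^{\mu\nu}\mathbf 1$. It is isomorphic as $*$-algebra to $M_{2^n}(\mathbb{C})$ via its unique (up to unitary equivalence) irreducible $*$-representation, and it is identified with $M_{2^n}(\mathbb{C})$ in this way. The element $\gamma=\prod_{\mu=1}^n[\Gamma^{\mu*},\Gamma^\mu]$ is hermitian, $\gamma^2=\mathbf 1$, and it anticommutes with all $\Gamma^\mu,\Gamma^{\mu*}$. One chooses the representation so that $\gamma=\begin{pmatrix}\mathbf 1&0\\0&-\mathbf 1\end{pmatrix}$ (blocks in $M_{2^{n-1}}(\mathbb{C})$);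 then $\Gamma^\mu=\begin{pmatrix}0&\sigma^\mu\\ \bar\sigma^{\mu*}&0\end{pmatrix}$, $\Gamma^{\mu*}=\begin{pmatrix}0&\bar\sigma^\mu\\ \sigma^{\mu*}&0\end{pmatrix}$, which defines $\sigma^\mu,\bar\sigma^\mu\in M_{2^{n-1}}(\mathbb{C})$. Chern character components (up to an irrelevant normalization), with $\tilde{\mathcal A}=\mathcal A/\mathbb{C}1$: for an idempotent $e\in M_q(\mathcal{A})$, $\mathrm{ch}_k(e)=\sum(e^{i_0}_{i_1}-\frac12\delta^{i_0}_{i_1})\otimes e^{i_1}_{i_2}\otimes\cdots\otimes e^{i_{2k}}_{i_0}\in\mathcal{A}\otimes\tilde{\mathcal{A}}^{\otimes2k}$; for a unitary $U\in M_q(\mathcal{A})$, $\mathrm{ch}_{k+\frac12}(U)=\sum\big(U^{i_0}_{i_1}\otimes(U^* )^{i_1}_{i_2}\otimes U^{i_2}_{i_3}\otimes\cdots\otimes(U^* )^{i_{2k+1}}_{i_0}-(U^* )^{i_0}_{i_1}\otimes U^{i_1}_{i_2}\otimes\cdots\otimes U^{i_{2k+1}}_{i_0}\big)\in\mathcal{A}\otimes\tilde{\mathcal{A}}^{\otimes(2k+1)}$. *)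

(* Defs.v *)
From HB Require Import structures.
From mathcomp Require Import all_boot all_order all_algebra.
From mathcomp Require Import generic_quotient ring_quotient finmap.
From mathcomp.real_closed Require Import complex.
From mathcomp Require Import boolp reals trigo.
From mathcomp Require Import xfinmap monalg.

Set Implicit Arguments.
Unset Strict Implicit.
Unset Printing Implicit Defensive.

Import Order.TTheory GRing.Theory Num.Theory.
Local Open Scope ring_scope.
Local Open Scope quotient_scope.

Section SubmodSpan.
Variables (C : pzRingType) (V : lmodType C) (S : V -> Prop).

Definition submod_span : {pred V} := fun v =>
  `[< forall W : {pred V}, submod_closed W ->
        (forall s, S s -> s \in W) -> v \in W >].

Lemma submod_spanP v : reflect (forall W : {pred V}, submod_closed W ->
    (forall s, S s -> s \in W) -> v \in W) (v \in submod_span).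
Proof. exact: asboolP. Qed.

Lemma submod_span_closed : submod_closed submod_span.
Proof.
split=> [|a u v /submod_spanP uS /submod_spanP vS].
  by apply/submod_spanP => W [].
apply/submod_spanP => W Wcl SW; case: (Wcl) => _ WZ.
by apply: WZ; [apply: uS | apply: vS].
Qed.

HB.instance Definition _ := GRing.isSubmodClosed.Build C V submod_span
  submod_span_closed.

End SubmodSpan.

Section LmodQuotient.
Variables (C : pzRingType) (V : lmodType C) (S : V -> Prop).

Definition lmod_quot : Type := Quotient.quot (submod_span S).
HB.instance Definition _ := GRing.Zmodule.on lmod_quot.
HB.instance Definition _ := EqQuotient.on lmod_quot.

Definition lq_pi : V -> lmod_quot := \pi_lmod_quot.

Lemma lq_eqP u v : reflect (lq_pi u = lq_pi v) (u - v \in submod_span S).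
Proof.
by rewrite /lq_pi Quotient.idealrBE; apply: eqP.
Qed.

Lemma lq_repr x : lq_pi (repr x) = x. Proof. exact: reprK. Qed.

Lemma lq_piD u v : lq_pi (u + v) = lq_pi u + lq_pi v.
Proof. by rewrite /lq_pi !piE. Qed.

Definition lq_scale (a : C) : lmod_quot -> lmod_quot :=
  lift_op1 lmod_quot (GRing.scale a : V -> V).

Lemma lq_piZ a v : lq_pi (a *: v) = lq_scale a (lq_pi v).
Proof.
rewrite /lq_scale; unlock; apply/lq_eqP; rewrite -/(lq_pi v).
by rewrite -scalerBr rpredZ //; apply/lq_eqP; rewrite lq_repr.
Qed.

Lemma lq_scaleA a b x : lq_scale a (lq_scale b x) = lq_scale (a * b) x.
Proof. by rewrite -[x]lq_repr -!lq_piZ scalerA. Qed.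

Lemma lq_scale1 : left_id 1 lq_scale.
Proof. by move=> x; rewrite -[x]lq_repr -lq_piZ scale1r. Qed.

Lemma lq_scaleDr : right_distributive lq_scale +%R.
Proof.
by move=> a x y; rewrite -[x]lq_repr -[y]lq_repr -lq_piD -!lq_piZ -lq_piD
  scalerDr.
Qed.

Lemma lq_scaleDl x : {morph lq_scale^~ x : a b / a + b}.
Proof. by move=> a b; rewrite -[x]lq_repr -!lq_piZ -lq_piD scalerDl. Qed.

HB.instance Definition _ := GRing.Zmodule_isLmodule.Build C lmod_quot
  lq_scaleA lq_scale1 lq_scaleDr lq_scaleDl.

Lemma lq_pi_linear : linear lq_pi.
Proof. by move=> a u v; rewrite lq_piD lq_piZ. Qed.

HB.instance Definition _ :=
  GRing.isLinear.Build C V lmod_quot _ lq_pi lq_pi_linear.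

End LmodQuotient.

Arguments lq_pi {C V} S _.

Section Tensor.
Variables (C : comNzRingType) (U V : lmodType C).

Variant tensor_relator : malg (U * V)%type C -> Prop :=
| TensorDl u u' v :
    tensor_relator (<< (u + u', v) >> - << (u, v) >> - << (u', v) >>)
| TensorDr u v v' :
    tensor_relator (<< (u, v + v') >> - << (u, v) >> - << (u, v') >>)
| TensorZl a u v : tensor_relator (<< (a *: u, v) >> - a *: << (u, v) >>)
| TensorZr a u v : tensor_relator (<< (u, a *: v) >> - a *: << (u, v) >>).

Definition tensor : lmodType C := lmod_quot tensor_relator.

Definition tens (u : U) (v : V) : tensor := lq_pi _ << (u, v) >>.

End Tensor.

(* [tensor_pow V W m] is V (x) W (x) ... (x) W with m factors W. *)
Fixpoint tensor_pow (C : comNzRingType) (V W : lmodType C) (m : nat) :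
    lmodType C :=
  if m is m'.+1 then tensor (tensor_pow V W m') W else V.

Fixpoint pure (C : comNzRingType) (V W : lmodType C) (m : nat) (v : V)
    (w : nat -> W) : tensor_pow V W m :=
  if m is m'.+1 then tens (pure m' v w) (w m') else v.

(* A unital complex *-algebra, as a ring A with a unital ring morphism from C
   to the centre of A.  This does not extend the library's [algType], where
   1 != 0 is required: an algebra given by generators and relations is not
   known a priori to be nonzero. *)
HB.mixin Record isStarAlgebra (C : numClosedFieldType) A of GRing.PzRing A := {
  scal : C -> A;
  scalB : forall c d, scal (c - d) = scal c - scal d;
  scal1 : scal 1 = 1;
  scalM : forall c d, scal (c * d) = scal c * scal d;
  scalC : forall c a, scal c * a = a * scal c;
  star : A -> A;
  starK : forall a, star (star a) = a;
  starD : forall a b, star (a + b) = star a + star b;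
  starM : forall a b, star (a * b) = star b * star a;
  star_scal : forall c, star (scal c) = scal c^*
}.

#[short(type="starAlgType")]
HB.structure Definition StarAlgebra (C : numClosedFieldType) :=
  {A of isStarAlgebra C A & GRing.PzRing A}.

Section StarAlgebraModule.
Variables (C : numClosedFieldType) (A : starAlgType C).

(* The vector space underlying A. *)
Definition vect_of : Type := A.
HB.instance Definition _ := GRing.Zmodule.on vect_of.

Definition vect_scale (c : C) (a : vect_of) : vect_of := scal c * (a : A).

Lemma vect_scaleA c d a : vect_scale c (vect_scale d a) = vect_scale (c * d) a.
Proof. by rewrite /vect_scale scalM mulrA. Qed.

Lemma vect_scale1 : left_id 1 vect_scale.
Proof. by move=> a; rewrite /vect_scale scal1 mul1r. Qed.

Lemma vect_scaleDr : right_distributive vect_scale +%R.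
Proof. by move=> c a b; rewrite /vect_scale mulrDr. Qed.

Lemma vect_scaleDl a : {morph vect_scale^~ a : c d / c + d}.
Proof.
move=> c d; rewrite /vect_scale -mulrDl; congr (_ * _).
have s0 : scal 0 = 0 :> A by rewrite -[0 in LHS](subrr 0) scalB subrr.
by rewrite -[d in LHS]opprK scalB -[- d]sub0r scalB s0 sub0r opprK.
Qed.

HB.instance Definition _ := GRing.Zmodule_isLmodule.Build C vect_of
  vect_scaleA vect_scale1 vect_scaleDr vect_scaleDl.

End StarAlgebraModule.

Section StarQuotient.
Variables (C : numClosedFieldType) (A : starAlgType C) (S : A -> Prop).

Definition star_ideal_closed (I : {pred A}) : Prop :=
  [/\ zmod_closed I,
      forall a x, x \in I -> a * x \in I,
      forall a x, x \in I -> x * a \in I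
    & forall x, x \in I -> star x \in I].

(* The *-ideal generated by S, i.e. the two-sided ideal generated by S and the
   adjoints of its elements. *)
Definition star_ideal : {pred A} := fun x =>
  `[< forall I : {pred A}, star_ideal_closed I ->
        (forall s, S s -> s \in I) -> x \in I >].

Lemma star_idealP x : reflect (forall I : {pred A}, star_ideal_closed I ->
    (forall s, S s -> s \in I) -> x \in I) (x \in star_ideal).
Proof. exact: asboolP. Qed.

Lemma star_idealB : zmod_closed star_ideal.
Proof.
split=> [|x y /star_idealP xI /star_idealP yI]; apply/star_idealP => I Icl SI.
  by case: (Icl) => -[].
by case: (Icl) => -[_ IB] _ _ _; apply: IB; [apply: xI | apply: yI].
Qed.

HB.instance Definition _ := GRing.isZmodClosed.Build A star_ideal star_idealB.

Lemma star_idealMl a x : x \in star_ideal -> a * x \in star_ideal.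
Proof.
move=> /star_idealP xI; apply/star_idealP => I Icl SI.
by case: (Icl) => _ Il _ _; apply/Il/xI.
Qed.

Lemma star_idealMr a x : x \in star_ideal -> x * a \in star_ideal.
Proof.
move=> /star_idealP xI; apply/star_idealP => I Icl SI.
by case: (Icl) => _ _ Ir _; apply/Ir/xI.
Qed.

Lemma star_ideal_star x : x \in star_ideal -> star x \in star_ideal.
Proof.
move=> /star_idealP xI; apply/star_idealP => I Icl SI.
by case: (Icl) => _ _ _ Is; apply/Is/xI.
Qed.

Definition star_quot : Type := Quotient.quot star_ideal.
HB.instance Definition _ := GRing.Zmodule.on star_quot.
HB.instance Definition _ := EqQuotient.on star_quot.

Definition sq_pi : A -> star_quot := \pi_star_quot.

Lemma sq_eqP x y : reflect (sq_pi x = sq_pi y) (x - y \in star_ideal).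
Proof. by rewrite /sq_pi Quotient.idealrBE; apply: eqP. Qed.

Lemma sq_repr x : sq_pi (repr x) = x. Proof. exact: reprK. Qed.

Lemma sq_piD x y : sq_pi (x + y) = sq_pi x + sq_pi y.
Proof. by rewrite /sq_pi !piE. Qed.

Lemma sq_piB x y : sq_pi (x - y) = sq_pi x - sq_pi y.
Proof. by rewrite /sq_pi !piE. Qed.

Definition sq_one : star_quot := lift_cst star_quot (1 : A).
Definition sq_mul : star_quot -> star_quot -> star_quot :=
  lift_op2 star_quot ( *%R : A -> A -> A).
Definition sq_scal : C -> star_quot := lift_embed star_quot (scal : C -> A).
Definition sq_star : star_quot -> star_quot :=
  lift_op1 star_quot (star : A -> A).

Lemma sq_pi1 : sq_pi 1 = sq_one.
Proof. by rewrite /sq_one; unlock. Qed.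

Lemma sq_pi_scal c : sq_pi (scal c) = sq_scal c.
Proof. by rewrite /sq_scal; unlock. Qed.

Lemma sq_piM x y : sq_pi (x * y) = sq_mul (sq_pi x) (sq_pi y).
Proof.
rewrite /sq_mul; unlock; apply/sq_eqP.
rewrite -/(sq_pi x) -/(sq_pi y); set x' := repr _; set y' := repr _.
have -> : x * y - x' * y' = (x - x') * y + x' * (y - y').
  by rewrite mulrBl mulrBr addrA subrK.
by rewrite rpredD //; [apply: star_idealMr | apply: star_idealMl];
  apply/sq_eqP; rewrite sq_repr.
Qed.

Lemma sq_pi_star x : sq_pi (star x) = sq_star (sq_pi x).
Proof.
rewrite /sq_star; unlock; apply/sq_eqP.
rewrite -/(sq_pi x); set x' := repr _.
have star0 : star 0 = 0 :> A.
  by apply: (addrI (star 0)); rewrite -starD !addr0.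
have starN a : star (- a) = - star a :> A.
  by apply: (addrI (star a)); rewrite -starD !subrr.
by rewrite -starN -starD star_ideal_star //; apply/sq_eqP; rewrite sq_repr.
Qed.

Lemma sq_mulA : associative sq_mul.
Proof.
by move=> x y z; rewrite -[x]sq_repr -[y]sq_repr -[z]sq_repr -!sq_piM mulrA.
Qed.

Lemma sq_mul1 : left_id sq_one sq_mul.
Proof. by move=> x; rewrite -[x]sq_repr -sq_pi1 -sq_piM mul1r. Qed.

Lemma sq_mulr1 : right_id sq_one sq_mul.
Proof. by move=> x; rewrite -[x]sq_repr -sq_pi1 -sq_piM mulr1. Qed.

Lemma sq_mulDl : left_distributive sq_mul +%R.
Proof.
move=> x y z; rewrite -[x]sq_repr -[y]sq_repr -[z]sq_repr.
by rewrite -sq_piD -!sq_piM -sq_piD mulrDl.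
Qed.

Lemma sq_mulDr : right_distributive sq_mul +%R.
Proof.
move=> x y z; rewrite -[x]sq_repr -[y]sq_repr -[z]sq_repr.
by rewrite -sq_piD -!sq_piM -sq_piD mulrDr.
Qed.

HB.instance Definition _ := GRing.Zmodule_isPzRing.Build star_quot
  sq_mulA sq_mul1 sq_mulr1 sq_mulDl sq_mulDr.

Lemma sq_pi_zmod_morphism : zmod_morphism sq_pi.
Proof. exact: sq_piB. Qed.

Lemma sq_pi_monoid_morphism : monoid_morphism sq_pi.
Proof. by split; [exact: sq_pi1 | exact: sq_piM]. Qed.

HB.instance Definition _ :=
  GRing.isZmodMorphism.Build A star_quot sq_pi sq_pi_zmod_morphism.
HB.instance Definition _ :=
  GRing.isMonoidMorphism.Build A star_quot sq_pi sq_pi_monoid_morphism.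

Lemma sq_scalB c d : sq_scal (c - d) = sq_scal c - sq_scal d.
Proof. by rewrite -!sq_pi_scal scalB rmorphB. Qed.

Lemma sq_scal1 : sq_scal 1 = 1.
Proof. by rewrite -sq_pi_scal scal1 rmorph1. Qed.

Lemma sq_scalM c d : sq_scal (c * d) = sq_scal c * sq_scal d.
Proof. by rewrite -!sq_pi_scal scalM rmorphM. Qed.

Lemma sq_scalC c x : sq_scal c * x = x * sq_scal c.
Proof. by rewrite -[x]sq_repr -sq_pi_scal -!rmorphM scalC. Qed.

Lemma sq_starK x : sq_star (sq_star x) = x.
Proof. by rewrite -[x]sq_repr -!sq_pi_star starK. Qed.

Lemma sq_starD x y : sq_star (x + y) = sq_star x + sq_star y.
Proof.
by rewrite -[x]sq_repr -[y]sq_repr -sq_piD -!sq_pi_star -sq_piD starD.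
Qed.

Lemma sq_starM x y : sq_star (x * y) = sq_star y * sq_star x.
Proof.
rewrite -[x]sq_repr -[y]sq_repr -rmorphM -!sq_pi_star -rmorphM.
by rewrite starM.
Qed.

Lemma sq_star_scal c : sq_star (sq_scal c) = sq_scal c^*.
Proof. by rewrite -!sq_pi_scal -sq_pi_star star_scal. Qed.

HB.instance Definition _ := isStarAlgebra.Build C star_quot
  sq_scalB sq_scal1 sq_scalM sq_scalC sq_starK sq_starD sq_starM sq_star_scal.

End StarQuotient.

Arguments sq_pi {C A} S _.

Section FreeStarAlgebra.
Variables (C : numClosedFieldType) (X : choiceType).

(* The letter (x, false) is the generator x and (x, true) is its adjoint. *)
Definition free_star : Type := malg (fmonom (X * bool)%type) C.
HB.instance Definition _ := GRing.Lalgebra.on free_star.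

Definition letter_star (l : X * bool) : X * bool := (l.1, ~~ l.2).

Definition word_star (w : fmonom (X * bool)%type) : fmonom (X * bool)%type :=
  FMonom (rev (map letter_star w)).

Definition free_star_star (p : free_star) : free_star :=
  \sum_(w <- msupp p) << (p@_w)^* *g word_star w >>.

Lemma letter_starK : involutive letter_star.
Proof. by case=> x b; rewrite /letter_star /= negbK. Qed.

Lemma word_starK : involutive word_star.
Proof.
case=> w; rewrite /word_star /= map_rev revK -map_comp map_id_in // => l _.
exact: letter_starK.
Qed.

Lemma word_starM (v w : fmonom (X * bool)%type) :
  word_star (mmul v w) = mmul (word_star w) (word_star v).
Proof.
rewrite /mmul /= !fmmulE /word_star /=.
by congr FMonom; rewrite map_cat rev_cat.
Qed.

Lemma free_star_starE (p : free_star) w :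
  (free_star_star p)@_w = (p@_(word_star w))^*.
Proof.
rewrite /free_star_star raddf_sum /=.
have [ws|ws] := boolP (word_star w \in msupp p).
  rewrite (bigD1_seq (word_star w)) ?fset_uniq //= mcoeffU word_starK eqxx.
  rewrite big1 ?addr0 // => v vw; rewrite mcoeffU.
  by rewrite (can2_eq word_starK word_starK) (negPf vw).
rewrite (mcoeff_outdom ws) conjC0 big_seq big1 // => v vp.
rewrite mcoeffU (can2_eq word_starK word_starK); case: eqP => // vw.
by rewrite -vw vp in ws.
Qed.

Lemma free_starK : involutive free_star_star.
Proof.
by move=> p; apply/malgP => w; rewrite !free_star_starE word_starK conjCK.
Qed.

Lemma free_starD : {morph free_star_star : p q / p + q}.
Proof.
move=> p q; apply/malgP => w.
by rewrite free_star_starE !mcoeffD !free_star_starE rmorphD.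
Qed.

Lemma free_starU c w :
  free_star_star << c *g w >> = << c^* *g word_star w >>.
Proof.
apply/malgP => v; rewrite free_star_starE !mcoeffU rmorphMn /=.
by rewrite (can2_eq word_starK word_starK).
Qed.

Lemma free_star_sum (I : Type) (r : seq I) (F : I -> free_star) :
  free_star_star (\sum_(i <- r) F i) = \sum_(i <- r) free_star_star (F i).
Proof.
apply: (big_morph _ free_starD).
by rewrite /free_star_star msupp0 big_seq_fset0.
Qed.

Lemma free_starM (p q : free_star) :
  free_star_star (p * q) = free_star_star q * free_star_star p.
Proof.
rewrite malgME free_star_sum [free_star_star p]/free_star_star mulr_sumr.
apply: eq_bigr => v _.
rewrite free_star_sum [free_star_star q]/free_star_star mulr_suml.
apply: eq_bigr => w _.
by rewrite free_starU word_starM rmorphM mulrC [RHS]fgmulUU.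
Qed.

Definition free_scal (c : C) : free_star := c%:MP.

Lemma free_scalB c d : free_scal (c - d) = free_scal c - free_scal d.
Proof. exact: raddfB. Qed.

Lemma free_scalM c d : free_scal (c * d) = free_scal c * free_scal d.
Proof. exact: mpolyCM. Qed.

Lemma free_scalC c p : free_scal c * p = p * free_scal c.
Proof.
rewrite [p]monalgE mulr_sumr mulr_suml; apply: eq_bigr => w _.
rewrite [LHS]fgmulUU [RHS]fgmulUU mulrC.
by congr (mkmalgU _ _); rewrite mulm1 mul1m.
Qed.

Lemma free_star_scal c : free_star_star (free_scal c) = free_scal c^*.
Proof.
rewrite free_starU; congr (mkmalgU _ _).
by apply/eqP; rewrite fmP /word_star /= fm1.
Qed.

HB.instance Definition _ := isStarAlgebra.Build C free_star
  free_scalB (erefl _) free_scalM free_scalC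
  free_starK free_starD free_starM free_star_scal.

Definition free_gen (x : X) : free_star := << fmu (x, false) >>.

End FreeStarAlgebra.

Arguments free_gen C {X} x.

Section ChernCharacter.
Variables (C : numClosedFieldType) (A : starAlgType C).

(* A / C 1 *)
Definition reduced : lmodType C :=
  lmod_quot (fun a : vect_of A => a = (1 : A)).

Definition chains (m : nat) : lmodType C := tensor_pow (vect_of A) reduced m.

(* The sum over all i_0, ..., i_m of
     (M_0)^{i_0}_{i_1} (x) (M_1)^{i_1}_{i_2} (x) ... (x) (M_m)^{i_m}_{i_0},
   where [inZp] reduces the subscript m.+1 to 0. *)
Definition cyclic_chain (q m : nat) (M : nat -> 'M[A]_q) : chains m :=
  \sum_(i : {ffun 'I_m.+1 -> 'I_q})
    let entry (j : nat) : vect_of A := M j (i (inZp j)) (i (inZp j.+1)) in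
    pure m (entry 0%N) (fun j => lq_pi _ (entry j.+1)).

Definition ch (k q : nat) (e : 'M[A]_q) : chains k.*2 :=
  cyclic_chain k.*2
    (fun j => if j == 0%N then e - (scal 2^-1)%:M else e).

Definition mxstar (q : nat) (M : 'M[A]_q) : 'M[A]_q := (map_mx star M)^T.

(* The component of degree k + 1/2. *)
Definition ch_half (k q : nat) (U : 'M[A]_q) : chains k.*2.+1 :=
  cyclic_chain k.*2.+1 (fun j => if odd j then mxstar U else U)
  - cyclic_chain k.*2.+1 (fun j => if odd j then U else mxstar U).

Definition mx_tens (p q : nat) (M : 'M[C]_(p, q)) (a : A) : 'M[A]_(p, q) :=
  map_mx (fun c => scal c * a) M.

End ChernCharacter.

Notation "M *t a" := (mx_tens M a) (at level 40, left associativity).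

Section NoncommutativeSpaces.
Variables (R : realType) (n : nat) (theta : 'M[R]_n).

(* e^{i theta_{mu nu}} *)
Definition phase (mu nu : 'I_n) : R[i] :=
  (cos (theta mu nu) +i* sin (theta mu nu))%C.

Variant plane_relator (A : starAlgType R[i]) (z : 'I_n -> A) : A -> Prop :=
| PlaneZZ mu nu : plane_relator z
    (z mu * z nu - scal (phase mu nu) * (z nu * z mu))
| PlaneZbZb mu nu : plane_relator z
    (star (z mu) * star (z nu)
     - scal (phase mu nu) * (star (z nu) * star (z mu)))
| PlaneZbZ mu nu : plane_relator z
    (star (z mu) * z nu - scal (phase nu mu) * (z nu * star (z mu))).

Definition plane_even : starAlgType R[i] :=
  star_quot (plane_relator (@free_gen R[i] 'I_n)).

Definition z_even (mu : 'I_n) : plane_even := sq_pi _ (free_gen _ mu).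

(* The generator x of the odd plane is [None]. *)
Variant plane_odd_relator : free_star R[i] (option 'I_n) -> Prop :=
| PlaneOddZ r :
    plane_relator (fun mu => free_gen _ (Some mu)) r -> plane_odd_relator r
| PlaneOddXstar : plane_odd_relator (star (free_gen _ None) - free_gen _ None)
| PlaneOddXZ mu : plane_odd_relator
    (free_gen _ None * free_gen _ (Some mu)
     - free_gen _ (Some mu) * free_gen _ None)
| PlaneOddXZb mu : plane_odd_relator
    (free_gen _ None * star (free_gen _ (Some mu))
     - star (free_gen _ (Some mu)) * free_gen _ None).

Definition plane_odd : starAlgType R[i] := star_quot plane_odd_relator.

Definition z_odd (mu : 'I_n) : plane_odd := sq_pi _ (free_gen _ (Some mu)).
Definition x_odd : plane_odd := sq_pi _ (free_gen _ None).

(* Both sphere relators are hermitian, so that the *-ideal they generate is the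
   two-sided ideal they generate. *)
Definition sphere_even : starAlgType R[i] :=
  star_quot (fun r : plane_odd =>
    r = \sum_mu z_odd mu * star (z_odd mu) + x_odd ^+ 2 - 1).

Definition u_gen (mu : 'I_n) : sphere_even := sq_pi _ (z_odd mu).
Definition u_last : sphere_even := sq_pi _ x_odd.

Definition sphere_odd : starAlgType R[i] :=
  star_quot (fun r : plane_even =>
    r = \sum_mu z_even mu * star (z_even mu) - 1).

Definition v_gen (mu : 'I_n) : sphere_odd := sq_pi _ (z_even mu).

Let G (mu : 'I_n) : free_star R[i] 'I_n := free_gen _ mu.

Variant cliff_relator : free_star R[i] 'I_n -> Prop :=
| CliffGG mu nu : cliff_relator
    (G mu * G nu + scal (phase nu mu) * (G nu * G mu))
| CliffGsGs mu nu : cliff_relator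
    (star (G mu) * star (G nu)
     + scal (phase nu mu) * (star (G nu) * star (G mu)))
| CliffGsG mu nu : cliff_relator
    (star (G mu) * G nu + scal (phase mu nu) * (G nu * star (G mu))
     - (mu == nu)%:R).

Definition cliff : starAlgType R[i] := star_quot cliff_relator.

Definition Gam (mu : 'I_n) : cliff := sq_pi _ (G mu).

Definition cliff_gamma : cliff :=
  \prod_(mu < n) (star (Gam mu) * Gam mu - Gam mu * star (Gam mu)).

(* For n > 0 the size of these matrices is 2 ^ n; it is written as a sum to
   allow for matrices made of blocks of size 2 ^ (n - 1). *)
Definition spin_mx : pzRingType := 'M[R[i]]_(2 ^ n.-1 + 2 ^ n.-1).

(* rho identifies Cliff with the full matrix algebra as a *-algebra, in such a
   way that gamma becomes block diagonal. *)
Record spin_identification (rho : {rmorphism cliff -> spin_mx}) : Prop := {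
  spin_scal : forall c, rho (scal c) = c%:M;
  spin_star : forall a, rho (star a) = (map_mx Num.conj (rho a))^T;
  spin_bij : bijective rho;
  spin_gamma : rho cliff_gamma = block_mx 1%:M 0 0 (- 1%:M)
}.

Section Spin.
Variable rho : {rmorphism cliff -> spin_mx}.

Definition spin_Gam (mu : 'I_n) : 'M[R[i]]_(2 ^ n.-1 + 2 ^ n.-1) :=
  rho (Gam mu).
Definition spin_GamS (mu : 'I_n) : 'M[R[i]]_(2 ^ n.-1 + 2 ^ n.-1) :=
  rho (star (Gam mu)).
Definition spin_gam : 'M[R[i]]_(2 ^ n.-1 + 2 ^ n.-1) := rho cliff_gamma.

Definition sigma (mu : 'I_n) : 'M[R[i]]_(2 ^ n.-1) := ursubmx (spin_Gam mu).
Definition sigma_bar (mu : 'I_n) : 'M[R[i]]_(2 ^ n.-1) :=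
  ursubmx (spin_GamS mu).

Definition even_projection : 'M[sphere_even]_(2 ^ n.-1 + 2 ^ n.-1) :=
  scal 2^-1 *: (1%:M
    + \sum_(mu < n) (spin_GamS mu *t u_gen mu + spin_Gam mu *t star (u_gen mu))
    + spin_gam *t u_last).

Definition odd_unitary : 'M[sphere_odd]_(2 ^ n.-1) :=
  \sum_(mu < n) (sigma_bar mu *t v_gen mu + sigma mu *t star (v_gen mu)).

End Spin.

End NoncommutativeSpaces.

(* Main.v *)
Require Import Defs.
From mathcomp Require Import all_boot all_order all_algebra.
From mathcomp.real_closed Require Import complex.
From mathcomp Require Import reals trigo.
From mathcomp Require Import monalg.

(* Write X for the sum of gen l (x) coord l over the 2n letters Gamma^mu*,
   Gamma^mu, with coordinates z^mu, zbar^mu.  The relations of Cliff and of the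
   plane are such that the terms of X^2 cancel in pairs, except for the diagonal
   ones, and X^2 = sum_mu z^mu zbar^mu.  The first halves of (i) and (ii) are
   the cases where this is 1 - u^2, with gamma (x) u added to X, and 1, with X
   written in blocks for the grading gamma.

   Expanding the chains multilinearly, ch_m(e) and ch_(m-1/2)(U) become sums
   over words with coefficients the traces of words of odd length < 2n + 1 in
   the Gamma^mu, Gamma^mu*, gamma; in (i) the scalar part of e only contributes
   to the first factor, where it is removed, as the others are taken modulo C 1.
   All these traces vanish.  Since [Gamma^mu* Gamma^mu, w] is a multiple of w,
   the factor being the number of Gamma^mu* minus that of Gamma^mu in w, a word
   of nonzero trace has as many Gamma^mu* as Gamma^mu, for each mu.  Hence gamma
   occurs an odd number of times, the phases between w and a Gamma^mu which does
   not occur in w cancel out, and such a mu exists since w is short.  Then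
   Gamma^mu w = - w Gamma^mu, and tr w = tr((Gamma^mu* Gamma^mu + Gamma^mu
   Gamma^mu* ) w) = 0 by cyclicity. *)

Set Implicit Arguments.
Unset Strict Implicit.
Unset Printing Implicit Defensive.

Import Order.TTheory GRing.Theory Num.Theory.
Local Open Scope ring_scope.

(** * Relators vanish in the quotients *)

Section Quotients.

Lemma lq_pi_rel (C : pzRingType) (V : lmodType C) (S : V -> Prop) s :
  S s -> lq_pi S s = 0.
Proof.
move=> Ss; rewrite -(linear0 (lq_pi S)); apply/lq_eqP; rewrite subr0.
by apply/submod_spanP => W _; apply.
Qed.

Lemma sq_pi_rel (C : numClosedFieldType) (A : starAlgType C) (S : A -> Prop) s :
  S s -> sq_pi S s = 0.
Proof.
move=> Ss; rewrite -(rmorph0 (sq_pi S)); apply/sq_eqP; rewrite subr0.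
by apply/star_idealP => I _; apply.
Qed.

Lemma lq_pi_one (C : numClosedFieldType) (A : starAlgType C) :
  lq_pi (fun a : vect_of A => a = (1 : A)) (1 : A) = 0.
Proof. exact: lq_pi_rel. Qed.

End Quotients.

(** * Bilinearity of the tensor product *)

Section TensorTheory.
Variables (C : comNzRingType) (U V : lmodType C).
Implicit Types (u : U) (v : V).

Lemma tensDl u u' v : tens (u + u') v = tens u v + tens u' v.
Proof.
have := lq_pi_rel (S := @tensor_relator C U V) (TensorDl u u' v).
by rewrite -addrA -opprD raddfB raddfD => /subr0_eq.
Qed.

Lemma tensDr u v v' : tens u (v + v') = tens u v + tens u v'.
Proof.
have := lq_pi_rel (S := @tensor_relator C U V) (TensorDr u v v').
by rewrite -addrA -opprD raddfB raddfD => /subr0_eq.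
Qed.

Lemma tensZl c u v : tens (c *: u) v = c *: tens u v.
Proof.
have := lq_pi_rel (S := @tensor_relator C U V) (TensorZl c u v).
rewrite raddfB => /subr0_eq E; exact: (etrans E (lq_piZ _ _ _)).
Qed.

Lemma tensZr c u v : tens u (c *: v) = c *: tens u v.
Proof.
have := lq_pi_rel (S := @tensor_relator C U V) (TensorZr c u v).
rewrite raddfB => /subr0_eq E; exact: (etrans E (lq_piZ _ _ _)).
Qed.

Lemma tens_suml (I : Type) (r : seq I) (P : pred I) (F : I -> U) v :
  tens (\sum_(i <- r | P i) F i) v = \sum_(i <- r | P i) tens (F i) v.
Proof.
elim/big_rec2: _ => [|i t u _ <-]; last by rewrite tensDl.
by rewrite -(scale0r 0) tensZl scale0r.
Qed.

Lemma tens_sumr (I : Type) (r : seq I) (P : pred I) u (F : I -> V) :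
  tens u (\sum_(i <- r | P i) F i) = \sum_(i <- r | P i) tens u (F i).
Proof.
elim/big_rec2: _ => [|i t v _ <-]; last by rewrite tensDr.
by rewrite -(scale0r 0) tensZr scale0r.
Qed.

End TensorTheory.

(** * Scalars, commutation up to a scalar, and weights in a star algebra *)

Section StarAlgebraTheory.
Variables (C : numClosedFieldType) (A : starAlgType C).
Implicit Types (c d : C) (x y a b : A).

Lemma scal0 : scal 0 = 0 :> A.
Proof. by rewrite -(subrr (0 : C)) scalB subrr. Qed.

Lemma scalN c : scal (- c) = - scal c :> A.
Proof. by rewrite -[- c]sub0r scalB scal0 sub0r. Qed.

Lemma scalD c d : scal (c + d) = scal c + scal d :> A.
Proof. by rewrite -[d in LHS]opprK scalB scalN opprK. Qed.

Lemma scal_sum (I : Type) (r : seq I) (F : I -> C) :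
  scal (\sum_(i <- r) F i) = \sum_(i <- r) scal (F i) :> A.
Proof. exact: (big_morph _ scalD scal0). Qed.

Lemma scal2 : scal 2 = 1 + 1 :> A.
Proof. by rewrite (natrD _ 1 1) scalD scal1. Qed.

(** This is how a division by 2 is carried out in a star algebra. *)
Lemma scal_half_double x : scal 2^-1 * (x + x) = x.
Proof.
rewrite -[x in x + x]mul1r -mulrDl -scal2 mulrA -scalM mulVf ?pnatr_eq0 //.
by rewrite scal1 mul1r.
Qed.

Lemma eq_opp0 x : x = - x -> x = 0.
Proof.
by move=> xN; rewrite -(scal_half_double x) [X in X + _]xN addNr mulr0.
Qed.

Lemma star0 : star 0 = 0 :> A.
Proof. by apply: (addrI (star 0)); rewrite -starD !addr0. Qed.

Lemma star1 : star 1 = 1 :> A.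
Proof. by rewrite -(@scal1 C A) star_scal conjC1. Qed.

Lemma scalAC c x y : x * (scal c * y) = scal c * (x * y).
Proof. by rewrite mulrA -scalC mulrA. Qed.

(** With the sign put into [c], this covers commuting, anticommuting and phase relations alike, and
    scalars multiply along products. *)
Definition qcomm c x y := x * y = scal c * (y * x).

Lemma qcomm1 x : qcomm 1 x 1.
Proof. by rewrite /qcomm scal1 !mul1r mulr1. Qed.

Lemma qcommM c d x y z : qcomm c x y -> qcomm d x z -> qcomm (c * d) x (y * z).
Proof.
rewrite /qcomm => xy xz.
by rewrite mulrA xy scalM -!mulrA xz (scalAC d y).
Qed.

Lemma qcommC c d x y : c * d = 1 -> qcomm c x y -> qcomm d y x.
Proof.
by move=> cd xy; rewrite /qcomm xy mulrA -scalM mulrC cd scal1 mul1r.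
Qed.

(** The hypothesis bears on the members of [r] only: in the trace argument, one generator absent
    from the word violates it. *)
Lemma qcomm_prod (I : eqType) (r : seq I) (c : I -> C) x (F : I -> A) :
  {in r, forall i, qcomm (c i) x (F i)} ->
  qcomm (\prod_(i <- r) c i) x (\prod_(i <- r) F i).
Proof.
elim: r => [|i r IHr] xF; first by rewrite !big_nil; apply: qcomm1.
rewrite !big_cons; apply: qcommM; first by apply: xF; rewrite mem_head.
by apply: IHr => j jr; apply: xF; rewrite inE jr orbT.
Qed.

Lemma qcomm1P x y : qcomm 1 x y <-> x * y = y * x.
Proof. by rewrite /qcomm scal1 mul1r. Qed.

Lemma qcommN1P x y : qcomm (-1) x y <-> x * y = - (y * x).
Proof. by rewrite /qcomm scalN scal1 mulN1r. Qed.

Lemma qcommBr c x y z : qcomm c x y -> qcomm c x z -> qcomm c x (y - z).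
Proof. by rewrite /qcomm mulrBr => -> ->; rewrite mulrBl mulrBr. Qed.

Lemma qcomm1_star x y : star x = x -> qcomm 1 x y -> qcomm 1 x (star y).
Proof.
move=> xx /qcomm1P/(congr1 star).
by rewrite !starM xx => yx; apply/qcomm1P; rewrite yx.
Qed.

(* [x] is an eigenvector, for the eigenvalue [c], of the derivation [h, -]. *)
Definition weight c h x := h * x = x * h + scal c * x.

Lemma weight1 h : weight 0 h 1.
Proof. by rewrite /weight scal0 mul0r addr0 mulr1 mul1r. Qed.

Lemma weightM c d h x y :
  weight c h x -> weight d h y -> weight (c + d) h (x * y).
Proof.
rewrite /weight => hx hy.
rewrite mulrA hx mulrDl -!mulrA hy mulrDr scalAC -addrA scalD mulrDl.
by rewrite [scal d * _ + _]addrC.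
Qed.

Lemma weight_prod (I : Type) (r : seq I) (c : I -> C) h (F : I -> A) :
  (forall i, weight (c i) h (F i)) ->
  weight (\sum_(i <- r) c i) h (\prod_(i <- r) F i).
Proof.
move=> hF; elim: r => [|i r IHr]; first by rewrite !big_nil; apply: weight1.
by rewrite !big_cons; apply: weightM.
Qed.

End StarAlgebraTheory.

(** * Transport of relations to quotients by star ideals *)

Section QuotientRelations.
Variables (C : numClosedFieldType) (A : starAlgType C) (S : A -> Prop).
Implicit Types (c : C) (x y r : A).

Lemma sq_piZ c x : sq_pi S (scal c * x) = scal c * sq_pi S x.
Proof. by rewrite rmorphM; congr (_ * _); apply: sq_pi_scal. Qed.

Lemma sq_pi_anticomm c x y r :
  sq_pi S (x * y + scal c * (y * x) - r) =
  sq_pi S x * sq_pi S y + scal c * (sq_pi S y * sq_pi S x) - sq_pi S r.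
Proof. by rewrite sq_piB sq_piD sq_piZ !rmorphM. Qed.

Lemma sq_pi_comm c x y :
  sq_pi S (x * y - scal c * (y * x)) =
  sq_pi S x * sq_pi S y - scal c * (sq_pi S y * sq_pi S x).
Proof. by rewrite sq_piB sq_piZ !rmorphM. Qed.

Lemma sq_pi_qcomm c x y :
  S (x * y - scal c * (y * x)) -> qcomm c (sq_pi S x) (sq_pi S y).
Proof. by move=> /sq_pi_rel; rewrite sq_pi_comm => /subr0_eq. Qed.

Lemma sq_pi_qcomm1 x y : S (x * y - y * x) -> qcomm 1 (sq_pi S x) (sq_pi S y).
Proof. by move=> xyS; apply: sq_pi_qcomm; rewrite scal1 mul1r. Qed.

Lemma sq_pi_qcommN c x y :
  S (x * y + scal c * (y * x)) -> qcomm (- c) (sq_pi S x) (sq_pi S y).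
Proof.
move=> /sq_pi_rel; rewrite -[X in sq_pi S X]subr0 sq_pi_anticomm rmorph0 subr0.
by rewrite /qcomm scalN mulNr => /eqP; rewrite addr_eq0 => /eqP.
Qed.

Lemma star_sq_pi x : star (sq_pi S x) = sq_pi S (star x).
Proof. exact: (esym (sq_pi_star S x)). Qed.

Lemma qcomm_sq_pi c (x y : A) : qcomm c x y -> qcomm c (sq_pi S x) (sq_pi S y).
Proof. by move=> /(congr1 (sq_pi S)); rewrite sq_piZ !rmorphM. Qed.

Lemma sq_pi_sum_star (I : finType) (z : I -> A) :
  sq_pi S (\sum_i z i * star (z i)) =
  \sum_i sq_pi S (z i) * star (sq_pi S (z i)).
Proof.
rewrite raddf_sum; apply: eq_bigr => i _.
by rewrite star_sq_pi -rmorphM.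
Qed.

Lemma sq_pi_sphere_odd (I : finType) (z : I -> A) :
  S (\sum_i z i * star (z i) - 1) ->
  \sum_i sq_pi S (z i) * star (sq_pi S (z i)) = 1.
Proof.
move=> /sq_pi_rel; rewrite sq_piB sq_pi_sum_star => /subr0_eq->.
exact: rmorph1.
Qed.

Lemma sq_pi_sphere_even (I : finType) (z : I -> A) (x : A) :
  S (\sum_i z i * star (z i) + x ^+ 2 - 1) ->
  \sum_i sq_pi S (z i) * star (sq_pi S (z i)) + sq_pi S x * sq_pi S x = 1.
Proof.
move=> /sq_pi_rel; rewrite sq_piB sq_piD sq_pi_sum_star expr2 => /subr0_eq.
by rewrite rmorph1 rmorphM.
Qed.

End QuotientRelations.

(** * Scalar matrices tensored with algebra elements, and adjoints *)

Section MatrixTensor.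
Variables (C : numClosedFieldType) (A : starAlgType C).

Lemma mx_tensM p q r (M : 'M[C]_(p, q)) (N : 'M[C]_(q, r)) (a b : A) :
  (M *t a) *m (N *t b) = (M *m N) *t (a * b).
Proof.
apply/matrixP => i j; rewrite !mxE scal_sum mulr_suml.
apply: eq_bigr => k _.
by rewrite !mxE scalM -mulrA [a * _]scalAC mulrA.
Qed.

Lemma mx_tensDl p q (M N : 'M[C]_(p, q)) (a : A) :
  (M + N) *t a = (M *t a) + (N *t a).
Proof. by apply/matrixP => i j; rewrite !mxE scalD mulrDl. Qed.

Lemma mx_tensNl p q (M : 'M[C]_(p, q)) (a : A) : (- M) *t a = - (M *t a).
Proof. by apply/matrixP => i j; rewrite !mxE scalN mulNr. Qed.

Lemma mx_tens0l p q (a : A) : (0 : 'M[C]_(p, q)) *t a = 0.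
Proof. by apply/matrixP => i j; rewrite !mxE scal0 mul0r. Qed.

Lemma mx_tensZl p q c (M : 'M[C]_(p, q)) (a : A) :
  (c *: M) *t a = M *t (scal c * a).
Proof. by apply/matrixP => i j; rewrite !mxE scalM scalAC mulrA. Qed.

Lemma mx_tensZ p q c (M : 'M[C]_(p, q)) (a : A) :
  (c *: M) *t a = scal c *: (M *t a).
Proof. by apply/matrixP => i j; rewrite !mxE scalM mulrA. Qed.

Lemma mx_tens1 q (a : A) : (1%:M : 'M[C]_q) *t a = a%:M.
Proof.
apply/matrixP => i j; rewrite !mxE; case: eqP => _ /=.
  by rewrite scal1 mul1r.
by rewrite scal0 mul0r.
Qed.

Lemma mxstar_tens q (M : 'M[C]_q) (a : A) :
  mxstar (M *t a) = (map_mx Num.conj M)^T *t star a.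
Proof. by apply/matrixP => i j; rewrite !mxE starM star_scal -scalC. Qed.

Lemma mxstarD q (M N : 'M[A]_q) : mxstar (M + N) = mxstar M + mxstar N.
Proof. by apply/matrixP => i j; rewrite !mxE starD. Qed.

Lemma mxstar_sum q (I : Type) (r : seq I) (F : I -> 'M[A]_q) :
  mxstar (\sum_(i <- r) F i) = \sum_(i <- r) mxstar (F i).
Proof.
apply: (big_morph _ (@mxstarD q)).
by apply/matrixP => i j; rewrite !mxE star0.
Qed.

Lemma scalZ_mxM p (c d : C) (M N : 'M[A]_p) :
  (scal c *: M) *m (scal d *: N) = scal (c * d) *: (M *m N).
Proof.
apply/matrixP => i j; rewrite !mxE mulr_sumr; apply: eq_bigr => k _.
by rewrite !mxE scalM -!mulrA [M i k * _]scalAC.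
Qed.

Lemma mxstarZ p (c : C) (M : 'M[A]_p) :
  mxstar (scal c *: M) = scal c^* *: mxstar M.
Proof. by apply/matrixP => i j; rewrite !mxE starM star_scal scalC. Qed.

Lemma mxstar1 p : mxstar (1%:M : 'M[A]_p) = 1%:M.
Proof.
apply/matrixP => i j; rewrite !mxE eq_sym.
by case: (i == j); rewrite ?star1 ?star0.
Qed.

Lemma block_mx_tens p (M N P Q : 'M[C]_p) (a : A) :
  block_mx M N P Q *t a = block_mx (M *t a) (N *t a) (P *t a) (Q *t a).
Proof. exact: map_block_mx. Qed.

Lemma mxstar_block p (M N P Q : 'M[A]_p) :
  mxstar (block_mx M N P Q) =
  block_mx (mxstar M) (mxstar P) (mxstar N) (mxstar Q).
Proof. by rewrite /mxstar map_block_mx tr_block_mx. Qed.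

Lemma sum_antidiag p (I : Type) (r : seq I) (F G : I -> 'M[A]_p) :
  \sum_(i <- r) block_mx 0 (F i) (G i) 0 =
  block_mx 0 (\sum_(i <- r) F i) (\sum_(i <- r) G i) 0.
Proof.
elim: r => [|i r IHr]; first by rewrite !big_nil block_mx0.
by rewrite !big_cons IHr add_block_mx !addr0.
Qed.

End MatrixTensor.

Lemma eq_oppmx (C : numFieldType) p (M : 'M[C]_p) : M = - M -> M = 0.
Proof.
move=> /matrixP MN; apply/matrixP => i j; apply/eqP.
by rewrite mxE -eqNr; apply/eqP; have := MN i j; rewrite !mxE => <-.
Qed.

Lemma lq_pi_scal (C : numClosedFieldType) (A : starAlgType C) c :
  lq_pi (fun a : vect_of A => a = (1 : A)) (scal c : A) = 0.
Proof.
have -> : scal c = c *: (1 : vect_of A) by rewrite -[LHS]mulr1.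
by rewrite lq_piZ lq_pi_one; apply: scaler0.
Qed.

Lemma lq_pi_add_scalar (C : numClosedFieldType) (A : starAlgType C) p
    (c : C) (N : 'M[A]_p) i j :
  lq_pi (fun a : vect_of A => a = (1 : A)) (((scal c)%:M + N) i j) =
  lq_pi (fun a : vect_of A => a = (1 : A)) (N i j).
Proof.
rewrite mxE lq_piD [(_)%:M i j]mxE; case: (i == j).
  by rewrite mulr1n lq_pi_scal add0r.
by rewrite mulr0n raddf0 add0r.
Qed.

(** * Expansion of cyclic chains into words *)

Section ChainExpansion.
Variables (C : numClosedFieldType) (A : starAlgType C).
Local Notation red := (lq_pi (fun a : vect_of A => a = (1 : A))).

Lemma pureS (V W : lmodType C) m (v : V) (w : nat -> W) :
  pure m.+1 v w = tens (pure m v w) (w m).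
Proof. by []. Qed.

Lemma eq_pure m (v : vect_of A) (w w' : nat -> reduced A) :
  (forall j, (j < m)%N -> w j = w' j) -> pure m v w = pure m v w'.
Proof.
elim: m => [|m IHm] ww'; first by [].
rewrite !pureS ww' ?ltnS ?leqnn //.
by rewrite IHm // => j jm; apply/ww'/ltnW.
Qed.

(** An open path with fixed endpoints admits a recursion on its length, which the cyclic sum does
    not; closing it up gives [cyclic_chain]. *)
Fixpoint path_chain q (M : nat -> 'M[A]_q) (m : nat) (a b : 'I_q) :
    chains A m :=
  if m is m'.+1 return chains A m
  then \sum_c tens (path_chain M m' a c) (red (M m'.+1 c b))
  else M 0%N a b.

Lemma path_chainS q (M : nat -> 'M[A]_q) m a b :
  path_chain M m.+1 a b =
  \sum_c tens (path_chain M m a c) (red (M m.+1 c b)).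
Proof. by []. Qed.

Definition rcons_ffun (I : finType) m (f : {ffun 'I_m -> I}) (c : I) :
    {ffun 'I_m.+1 -> I} :=
  [ffun j => if unlift ord_max j is Some k then f k else c].

Lemma rcons_ffun0 (I : finType) m (f : {ffun 'I_m.+1 -> I}) c :
  rcons_ffun f c ord0 = f ord0.
Proof.
have -> : ord0 = lift ord_max (@ord0 m) by apply/val_inj.
by rewrite ffunE liftK.
Qed.

Lemma big_ffun_recr (V : nmodType) (I : finType) m
    (F : {ffun 'I_m.+1 -> I} -> V) :
  \sum_f F f = \sum_c \sum_(f : {ffun 'I_m -> I}) F (rcons_ffun f c).
Proof.
pose h (p : I * {ffun 'I_m -> I}) := rcons_ffun p.2 p.1.
rewrite pair_bigA (reindex h) /=; first by [].
exists (fun f => (f ord_max, [ffun k => f (lift ord_max k)])) => [[c f]|f] _ /=.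
  congr (_, _); first by rewrite ffunE unlift_none.
  by apply/ffunP => k; rewrite !ffunE liftK.
apply/ffunP => j; rewrite !ffunE; case: unliftP => [k|] -> //=.
by rewrite ffunE.
Qed.

(** The default [b] plays the right endpoint of a path. *)
Definition ext_ffun (I : Type) m (f : {ffun 'I_m -> I}) (b : I) (j : nat) : I :=
  if insub j is Some k then f k else b.

Lemma ext_ffun_recr (I : finType) m (f : {ffun 'I_m -> I}) (c b : I) j :
  ext_ffun (rcons_ffun f c) b j
  = if (j <= m)%N then ext_ffun f c j else b.
Proof.
rewrite /ext_ffun -ltnS; case: insubP => [k jm kj|/negPf-> //].
rewrite jm ffunE; case: unliftP kj => [l|] -> /=.
  rewrite /bump leqNgt ltn_ord add0n => <-.
  by case: insubP => [i _ /val_inj -> //|]; rewrite ltn_ord.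
by move=> <-; case: insubP; rewrite ?ltnn.
Qed.

Lemma path_chainE q (M : nat -> 'M[A]_q) m a b :
  path_chain M m a b =
  \sum_(f : {ffun 'I_m.+1 -> 'I_q} | f ord0 == a)
    pure m (M 0%N (ext_ffun f b 0) (ext_ffun f b 1) : vect_of A)
      (fun j => red (M j.+1 (ext_ffun f b j.+1) (ext_ffun f b j.+2))).
Proof.
elim: m b => [|m IHm] b.
  rewrite (big_pred1 [ffun=> a]) => [/=|f].
    by rewrite /ext_ffun; case: insubP => //= k _ _; rewrite ffunE insubF.
  apply/eqP/eqP => [fa|->]; last by rewrite ffunE.
  by apply/ffunP => j; rewrite ffunE ord1.
rewrite [RHS]big_mkcond big_ffun_recr path_chainS; apply: eq_bigr => c _.
rewrite IHm tens_suml [LHS]big_mkcond; apply: eq_bigr => f _.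
rewrite rcons_ffun0; case: (f ord0 == a); last by [].
rewrite pureS !ext_ffun_recr !leqnn ltnn.
have -> : ext_ffun f c m.+1 = c by rewrite /ext_ffun insubF ?ltnn.
(* The first [m] reduced factors use positions up to [m.+1] only, where [rcons_ffun f c] extended by
   [b] agrees with [f] extended by [c]. *)
rewrite -[in LHS](@eq_pure m _ (fun j => red (M j.+1
  (ext_ffun (rcons_ffun f c) b j.+1) (ext_ffun (rcons_ffun f c) b j.+2)))) //.
by move=> j jm; rewrite !ext_ffun_recr !ltnS jm ltnW.
Qed.

Lemma cyclic_chainE q (M : nat -> 'M[A]_q) m :
  cyclic_chain m M = \sum_a path_chain M m a a.
Proof.
rewrite /cyclic_chain.
rewrite (partition_big (fun f : {ffun 'I_m.+1 -> 'I_q} => f ord0) xpredT) //=.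
apply: eq_bigr => a _; rewrite path_chainE; apply: eq_bigr => f /eqP fa.
(* At position [m.+1], [inZp] wraps around to 0 while [ext_ffun] returns its default [a]; both give
   [f ord0]. *)
have fE j : (j <= m.+1)%N -> f (inZp j) = ext_ffun f a j.
  rewrite leq_eqVlt /ext_ffun => /predU1P[->|jm].
    rewrite insubF ?ltnn // -fa; congr (f _).
    by apply/val_inj; rewrite /= modnn.
  rewrite insubT /=; congr (f _); apply/val_inj => /=; exact: modn_small.
rewrite !fE //; apply: eq_pure => j jm; rewrite !fE // ltnS; exact: ltnW.
Qed.

Lemma eq_path_chain q (M M' : nat -> 'M[A]_q) m :
  M 0%N = M' 0%N ->
  (forall j a b, red (M j.+1 a b) = red (M' j.+1 a b)) ->
  path_chain M m =2 path_chain M' m.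
Proof.
move=> M0 MS; elim: m => [|m IHm] a b; first by rewrite /= M0.
by rewrite !path_chainS; apply: eq_bigr => c _; rewrite IHm MS.
Qed.

Lemma eq_cyclic_chain q m (M M' : nat -> 'M[A]_q) :
  M 0%N = M' 0%N ->
  (forall j a b, red (M j.+1 a b) = red (M' j.+1 a b)) ->
  cyclic_chain m M = cyclic_chain m M'.
Proof.
move=> M0 MS; rewrite !cyclic_chainE.
by apply: eq_bigr => a _; apply: eq_path_chain.
Qed.

Section Words.
Variables (L : finType) (x : L -> A).

(* Words are read from right to left. *)
Fixpoint chain_terms (m : nat) : seq (seq L * chains A m) :=
  if m is m'.+1 return seq (seq L * chains A m)
  then [seq (l :: p.1, tens p.2 (red (x l))) | p <- chain_terms m', l <- enum L]
  else [seq ([:: l], x l : vect_of A) | l <- enum L].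

Lemma size_chain_terms m : all (fun p => size p.1 == m.+1) (chain_terms m).
Proof.
elim: m => [|m /allP IHm]; first by rewrite all_map; apply/allP.
by apply/allP => p /allpairsPdep[p' [l [p'm _ ->]]]; rewrite /= eqSS IHm.
Qed.

(** Words being stored in reverse, the length of the tail is the position of the head letter.
    Matrices may depend on it, as the alternation of [U] and [mxstar U] requires. *)
Fixpoint word_mx q (S : nat -> L -> 'M[C]_q) (w : seq L) : 'M[C]_q :=
  if w is l :: w' then word_mx S w' *m S (size w') l else 1%:M.

Lemma red_sum_tens q (S : L -> 'M[C]_q) a b :
  red ((\sum_l (S l *t x l)) a b) = \sum_l S l a b *: red (x l).
Proof.
rewrite summxE raddf_sum; apply: eq_bigr => l _.
by rewrite !mxE; apply: (linearZ_LR (lq_pi _) (S l a b) (x l : vect_of A)).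
Qed.

Lemma path_chain_words q (S : nat -> L -> 'M[C]_q) m a b :
  path_chain (fun j => \sum_l (S j l *t x l)) m a b =
  \sum_(p <- chain_terms m) word_mx S p.1 a b *: p.2.
Proof.
elim: m b => [|m IHm] b.
  rewrite big_map big_enum /= summxE; apply: eq_bigr => l _.
  by rewrite mul1mx !mxE.
rewrite path_chainS.
transitivity (\sum_c \sum_(p <- chain_terms m) \sum_l
    (word_mx S p.1 a c * S m.+1 l c b) *: tens p.2 (red (x l))).
  apply: eq_bigr => c _; rewrite IHm tens_suml; apply: eq_bigr => p _.
  rewrite red_sum_tens tens_sumr; apply: eq_bigr => l _.
  by rewrite tensZl tensZr scalerA.
rewrite exchange_big big_allpairs_dep; apply: eq_big_seq => p p_m.
rewrite exchange_big big_enum; apply: eq_bigr => l _ /=.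
(* All these words have length [m.+1], so the new letter sits at position [m.+1]; the sum over [c]
   is then an entry of a matrix product. *)
rewrite (eqP (allP (size_chain_terms m) p p_m)) mxE.
by rewrite -scaler_suml.
Qed.

(** The chains [p.2] do not depend on the endpoints, so closing the paths turns the matrix
    coefficients into traces. *)
Lemma cyclic_chain_words q (S : nat -> L -> 'M[C]_q) m :
  cyclic_chain m (fun j => \sum_l (S j l *t x l)) =
  \sum_(p <- chain_terms m) \tr (word_mx S p.1) *: p.2.
Proof.
rewrite cyclic_chainE; under eq_bigr do rewrite path_chain_words.
by rewrite exchange_big; apply: eq_bigr => p _; rewrite -scaler_suml.
Qed.

End Words.

End ChainExpansion.

(** * Sums and products over letters, and letter counts *)

Lemma big_pair_bool (R : Type) (idx : R) (op : Monoid.com_law idx)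
    (I : finType) (F : I * bool -> R) :
  \big[op/idx]_l F l = \big[op/idx]_i op (F (i, true)) (F (i, false)).
Proof.
transitivity (\big[op/idx]_i \big[op/idx]_b F (i, b)).
  by rewrite pair_bigA; apply: eq_bigr => -[].
by apply: eq_bigr => i _; rewrite big_bool.
Qed.

Lemma big_option (R : Type) (idx : R) (op : Monoid.com_law idx)
    (I : finType) (F : option I -> R) :
  \big[op/idx]_l F l = op (F None) (\big[op/idx]_i F (Some i)).
Proof.
rewrite (bigD1 None) //=; congr (op _ _).
rewrite (reindex_omap Some id) => [|[l|]] //=.
by apply: eq_bigl => l; rewrite eqxx.
Qed.

Lemma sum_count_mem (V : nmodType) (L : finType) (w : seq L) (F : L -> V) :
  \sum_(l <- w) F l = \sum_l F l *+ count_mem l w.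
Proof.
elim: w => [|a w IHw]; first by rewrite big_nil big1.
rewrite big_cons IHw [in RHS](bigD1 a) //= eqxx mulrS -addrA; congr (_ + _).
rewrite (bigD1 a) //=; congr (_ + _); apply: eq_bigr => l la.
by rewrite eq_sym (negPf la).
Qed.

Lemma prod_count_mem (V : comPzRingType) (L : finType) (w : seq L)
    (F : L -> V) :
  \prod_(l <- w) F l = \prod_l F l ^+ count_mem l w.
Proof.
elim: w => [|a w IHw]; first by rewrite big_nil big1.
rewrite big_cons IHw [in RHS](bigD1 a) //= eqxx exprS -mulrA; congr (_ * _).
rewrite (bigD1 a) //=; congr (_ * _); apply: eq_bigr => l la.
by rewrite eq_sym (negPf la).
Qed.

Lemma size_count_mem (L : finType) (w : seq L) :
  size w = (\sum_l count_mem l w)%N.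
Proof.
rewrite -sum1_size (sum_count_mem w (fun=> 1%N)); apply: eq_bigr => l _.
by rewrite -mulr_natr mul1r natn.
Qed.

(** * Relations in the deformed Clifford algebra *)

Section Clifford.
Variables (R : realType) (n : nat) (theta : 'M[R]_n).
Hypothesis theta_skew : theta^T = - theta.
Local Notation C := R[i].
Local Notation cl := (cliff theta).
Local Notation G := (Gam theta).
Local Notation Gs mu := (star (Gam theta mu)).
Local Notation gamma := (cliff_gamma theta).
Local Notation ph := (phase theta).

Lemma thetaN mu nu : theta nu mu = - theta mu nu.
Proof. by have /matrixP/(_ mu nu) := theta_skew; rewrite !mxE. Qed.

Lemma phaseV mu nu : ph mu nu * ph nu mu = 1.
Proof.
rewrite /phase (thetaN mu nu) cosN sinN; apply/eqP; rewrite eq_complex /=.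
rewrite mulrN opprK -!expr2 cos2Dsin2 eqxx /=.
by rewrite mulrN mulrC addNr eqxx.
Qed.

Lemma phase_id mu : ph mu mu = 1.
Proof.
have t0 : theta mu mu = 0.
  by apply/eqP; rewrite -eqNr -thetaN.
by rewrite /phase t0 cos0 sin0.
Qed.

Lemma Gam_star mu : Gs mu = sq_pi _ (star (free_gen C mu)).
Proof. exact: star_sq_pi. Qed.

Lemma GamGam mu nu : qcomm (- ph nu mu) (G mu) (G nu).
Proof. exact/sq_pi_qcommN/CliffGG. Qed.

Lemma GamsGams mu nu : qcomm (- ph nu mu) (Gs mu) (Gs nu).
Proof. rewrite !Gam_star; exact/sq_pi_qcommN/CliffGsGs. Qed.

Lemma GamsGam mu nu :
  Gs mu * G nu + scal (ph mu nu) * (G nu * Gs mu) = (mu == nu)%:R.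
Proof.
have := sq_pi_rel (CliffGsG theta mu nu); rewrite Gam_star sq_pi_anticomm.
by move/subr0_eq->; apply: rmorph_nat.
Qed.

Lemma GamsGam_ne mu nu : mu != nu -> qcomm (- ph mu nu) (Gs mu) (G nu).
Proof.
move=> /negPf mn; have := GamsGam mu nu; rewrite mn /qcomm scalN mulNr.
by move=> /eqP; rewrite addr_eq0 => /eqP.
Qed.

Lemma GamGams_ne mu nu : mu != nu -> qcomm (- ph mu nu) (G mu) (Gs nu).
Proof.
rewrite eq_sym => /GamsGam_ne; apply: qcommC.
by rewrite mulrNN phaseV.
Qed.

Lemma Gam_sq mu : G mu * G mu = 0.
Proof.
apply: eq_opp0; have := GamGam mu mu.
by rewrite /qcomm phase_id scalN scal1 mulN1r.
Qed.

Lemma Gams_sq mu : Gs mu * Gs mu = 0.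
Proof. by rewrite -starM Gam_sq star0. Qed.

Lemma Gam_anticomm mu : Gs mu * G mu + G mu * Gs mu = 1.
Proof. by have := GamsGam mu mu; rewrite phase_id eqxx scal1 mul1r. Qed.

(** The number operator of the mode [mu]: [Gs mu] raises it by 1 and [G mu] lowers it by 1, see
    [gen_weight]. *)
Definition number_op mu : cl := Gs mu * G mu.

Lemma star_number_op mu : star (number_op mu) = number_op mu.
Proof. by rewrite /number_op starM starK. Qed.

(** The phases of [G mu] with the two factors of [number_op nu] are inverse to each other, and the
    two signs cancel. *)
Lemma Gam_number_op_ne mu nu : mu != nu -> qcomm 1 (G mu) (number_op nu).
Proof.
move=> mn; rewrite -(phaseV mu nu) -[X in qcomm X _ _]mulrNN.
by apply: qcommM; [apply: GamGams_ne | apply: GamGam].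
Qed.

Lemma Gams_number_op_ne mu nu : mu != nu -> qcomm 1 (Gs mu) (number_op nu).
Proof.
move=> /Gam_number_op_ne/(qcommC (mulr1 1))/(qcomm1_star (star_number_op nu)).
exact: qcommC (mulr1 1).
Qed.

Definition gam_comm (mu : 'I_n) : cl := Gs mu * G mu - G mu * Gs mu.

(** Reduces commutation with a factor of gamma to commutation with a number operator. *)
Lemma gam_commE mu : gam_comm mu = number_op mu + number_op mu - 1.
Proof.
rewrite /gam_comm -[X in _ = _ - X](Gam_anticomm mu) /number_op.
by rewrite opprD addrA addrK.
Qed.

Lemma Gam_gam_comm_ne mu nu : mu != nu -> qcomm 1 (G mu) (gam_comm nu).
Proof.
move=> /Gam_number_op_ne mn; rewrite gam_commE.
apply: qcommBr; last exact: qcomm1.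
by move/qcomm1P: mn => mn; apply/qcomm1P; rewrite mulrDr mn mulrDl.
Qed.

(** Since [G mu] squares to zero, only G Gs G survives on either side, with opposite signs. *)
Lemma Gam_gam_comm mu : qcomm (-1) (G mu) (gam_comm mu).
Proof.
apply/qcommN1P; rewrite /gam_comm mulrBr mulrBl !mulrA Gam_sq mul0r subr0.
by rewrite -!mulrA Gam_sq mulr0 sub0r opprK mulrA.
Qed.

Lemma Gam_gamma mu : qcomm (-1) (G mu) gamma.
Proof.
(* [G mu] anticommutes with its own factor of gamma and commutes with the others; in a
   duplicate-free list its own factor occurs at most once. *)
suff E (r : seq 'I_n) : uniq r ->
    qcomm (if mu \in r then -1 else 1) (G mu) (\prod_(nu <- r) gam_comm nu).
  by have := E _ (index_enum_uniq 'I_n); rewrite mem_index_enum.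
elim: r => [_|nu r IHr /= /andP[nur /IHr]].
  by rewrite big_nil; apply: qcomm1.
rewrite big_cons inE; case: eqVneq => [->|mn] /= Hr.
  rewrite (negPf nur) in Hr; rewrite -[X in qcomm X _ _]mulr1.
  by apply: qcommM => //; apply: Gam_gam_comm.
rewrite -[X in qcomm X _ _]mul1r; apply: qcommM => //.
  exact: Gam_gam_comm_ne.
Qed.

Lemma number_opC mu nu : qcomm 1 (number_op mu) (number_op nu).
Proof.
have [->|mn] := eqVneq mu nu; first exact/qcomm1P.
apply: (qcommC (mulr1 1)); rewrite -[X in qcomm X _ _](mulr1 1).
apply: qcommM; apply: (qcommC (mulr1 1)).
  exact: Gams_number_op_ne.
exact: Gam_number_op_ne.
Qed.

Lemma number_op_gam_comm mu nu : qcomm 1 (number_op mu) (gam_comm nu).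
Proof.
rewrite gam_commE; apply: qcommBr; last exact: qcomm1.
have /qcomm1P mn := number_opC mu nu.
by apply/qcomm1P; rewrite mulrDr mn mulrDl.
Qed.

Lemma number_op_gamma mu : qcomm 1 (number_op mu) gamma.
Proof.
have := qcomm_prod (r := index_enum 'I_n) (c := fun=> 1)
  (fun nu _ => number_op_gam_comm mu nu).
by rewrite big1.
Qed.

Definition letter := option ('I_n * bool).

Definition gen (l : letter) : cl :=
  if l is Some (mu, b) then if b then Gs mu else G mu else gamma.

Definition charge (nu : 'I_n) (l : letter) : C :=
  if l is Some (mu, b) then
    if mu == nu then if b then 1 else -1 else 0
  else 0.

Lemma gen_weight nu l : weight (charge nu l) (number_op nu) (gen l).
Proof.
rewrite /weight; case: l => [[mu b]|] /=; last first.
  by have /qcomm1P-> := number_op_gamma nu; rewrite scal0 mul0r addr0.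
case: eqVneq => [->|mn].
  (* In the mode [nu] itself, 1 = Gs G + G Gs is inserted and the squares vanish. *)
  case: b; rewrite /number_op ?scalN scal1 ?mulN1r ?mul1r.
    rewrite mulrA Gams_sq mul0r add0r -[RHS]mulr1 -(Gam_anticomm nu) mulrDr.
    by rewrite mulrA Gams_sq mul0r add0r mulrA.
  rewrite -mulrA Gam_sq mulr0 -[X in _ - X]mulr1 -(Gam_anticomm nu) mulrDr.
  by rewrite [X in _ - (_ + X)]mulrA Gam_sq mul0r addr0 subrr.
rewrite scal0 mul0r addr0; case: b; apply/esym/qcomm1P.
  exact: Gams_number_op_ne.
exact: Gam_number_op_ne.
Qed.

Definition gen_phase (mu : 'I_n) (l : letter) : C :=
  if l is Some (nu, b) then if b then - ph mu nu else - ph nu mu else -1.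

(** The excluded letter is the one whose relation with [G mu] has the inhomogeneous term 1. *)
Lemma gen_qcomm mu l :
  l != Some (mu, true) -> qcomm (gen_phase mu l) (G mu) (gen l).
Proof.
case: l => [[nu []]|].
- by move=> mn; apply: GamGams_ne; apply: contraNneq mn => ->.
- by move=> _; apply: GamGam.
- by move=> _; apply: Gam_gamma.
Qed.

(** * Vanishing of traces of short words of odd length *)

Section TraceOfWords.
Variable tau : cl -> C.
Hypothesis tauD : {morph tau : a b / a + b}.
Hypothesis tauZ : forall c a, tau (scal c * a) = c * tau a.
Hypothesis tau_cycl : forall a b, tau (a * b) = tau (b * a).

(** The trace of the commutator of [h] and [x] is zero. *)
Lemma tau_weight c h x : weight c h x -> c * tau x = 0.
Proof.
rewrite /weight => /(congr1 tau); rewrite tauD tauZ tau_cycl => /esym/eqP.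
by rewrite -subr_eq0 addrC addrA addNr add0r => /eqP.
Qed.

Lemma tauN x : tau (- x) = - tau x.
Proof. by rewrite -[- x]mulN1r -(@scal1 C cl) -scalN tauZ mulN1r. Qed.

Lemma tau_Gam_anticomm mu x : qcomm (-1) (G mu) x -> tau x = 0.
Proof.
move=> /qcommN1P Gx; rewrite -[x]mul1r -(Gam_anticomm mu) mulrDl tauD.
rewrite -mulrA Gx mulrN tauN [X in - X]tau_cycl -[X in - tau X]mulrA.
by rewrite [tau (x * _)]tau_cycl addNr.
Qed.

Lemma tau_word (w : seq letter) :
  odd (size w) -> (size w <= n.*2)%N -> tau (\prod_(l <- w) gen l) = 0.
Proof.
move=> w_odd w_le; apply/eqP; case: eqVneq => // tau0.
pose p (mu : 'I_n) b := count_mem (Some (mu, b)) w.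
(* A nonzero trace forces total charge 0 in the mode [mu]; gamma and the other modes contribute
   nothing, and the counts agree in characteristic 0. *)
have neutral mu : p mu true = p mu false.
  have /tau_weight/eqP := weight_prod w (gen_weight mu).
  rewrite mulf_eq0 (negPf tau0) orbF sum_count_mem big_option big_pair_bool /=.
  rewrite mul0rn add0r (bigD1 mu) //= big1 => [|nu nm]; last first.
    by rewrite (negPf nm) !mul0rn addr0.
  rewrite eqxx addr0 mulNrn subr_eq0 eqr_nat.
  by move/eqP.
have size_w : size w = (count_mem None w + (\sum_mu p mu false).*2)%N.
  rewrite size_count_mem big_option big_pair_bool /=; congr (_ + _)%N.
  rewrite -muln2 big_distrl; apply: eq_bigr => mu _ /=.
  by rewrite -/(p mu true) neutral muln2 addnn.
have odd_gamma : odd (count_mem None w).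
  by move: w_odd; rewrite size_w oddD odd_double addbF.
(* If every mode occurred, [w] would contain n pairs and, by oddness, a gamma, hence more than 2n
   letters. *)
have /existsP[mu /eqP p0] : [exists mu, p mu false == 0%N].
  apply: contraLR w_le => /existsPn p_gt0.
  rewrite -ltnNge size_w.
  have : (n <= \sum_mu p mu false)%N.
    rewrite -[n in (n <= _)%N]card_ord -sum1_card leq_sum // => mu _.
    by rewrite lt0n.
  rewrite -leq_double => /leq_ltn_trans; apply.
  by rewrite -[X in (X < _)%N]add0n ltn_add2r; case: count odd_gamma.
case/eqP: tau0; apply: (@tau_Gam_anticomm mu).
(* The odd number of gammas gives -1; by neutrality the other phases pair up as
   [ph mu nu * ph nu mu = 1]. *)
have -> : -1 = \prod_(l <- w) gen_phase mu l.
  rewrite prod_count_mem big_option big_pair_bool /= -signr_odd odd_gamma expr1.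
  rewrite big1 ?mulr1 // => nu _.
  by rewrite -/(p nu true) neutral -exprMn mulrNN phaseV expr1n.
(* By neutrality the adjoint letter of [mu], the exception in [gen_qcomm], is absent as well. *)
apply: qcomm_prod => l lw; apply: gen_qcomm; apply: contraTneq lw => ->.
by rewrite -has_pred1 has_count -/(p mu true) neutral p0.
Qed.

End TraceOfWords.

End Clifford.

(** * Relations between the coordinates of the spheres *)

Section PlaneRelations.
Variables (R : realType) (n : nat) (theta : 'M[R]_n).

(** Isolates what the coordinates of both spheres share, so that X is squared once for [u_gen] and
    [v_gen]. *)
Record plane_comm (A : starAlgType R[i]) (z : 'I_n -> A) : Prop := {
  plane_zz : forall mu nu, qcomm (phase theta mu nu) (z mu) (z nu);
  plane_zbzb : forall mu nu,
    qcomm (phase theta mu nu) (star (z mu)) (star (z nu));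
  plane_zbz : forall mu nu, qcomm (phase theta nu mu) (star (z mu)) (z nu)
}.

Lemma plane_comm_quot (A : starAlgType R[i]) (S : A -> Prop) (z : 'I_n -> A) :
  (forall r, plane_relator theta z r -> S r) ->
  plane_comm (fun mu => sq_pi S (z mu)).
Proof.
move=> zS; split=> mu nu; rewrite ?star_sq_pi; apply/sq_pi_qcomm/zS.
- exact: PlaneZZ.
- exact: PlaneZbZb.
- exact: PlaneZbZ.
Qed.

Lemma plane_comm_sq_pi (A : starAlgType R[i]) (S : A -> Prop) (z : 'I_n -> A) :
  plane_comm z -> plane_comm (fun mu => sq_pi S (z mu)).
Proof.
case=> zz zbzb zbz.
by split=> mu nu; rewrite ?star_sq_pi; apply: qcomm_sq_pi.
Qed.

Lemma u_gen_comm : plane_comm (u_gen theta).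
Proof. by apply/plane_comm_sq_pi/plane_comm_quot => r; apply: PlaneOddZ. Qed.

Lemma v_gen_comm : plane_comm (v_gen theta).
Proof. exact/plane_comm_sq_pi/plane_comm_quot. Qed.

Lemma star_u_last : star (u_last theta) = u_last theta.
Proof.
rewrite /u_last star_sq_pi; congr (sq_pi _ _); rewrite /x_odd star_sq_pi.
have := sq_pi_rel (PlaneOddXstar theta); rewrite sq_piB => /subr0_eq.
exact.
Qed.

Lemma u_last_comm mu : qcomm 1 (u_last theta) (u_gen theta mu).
Proof. exact/qcomm_sq_pi/sq_pi_qcomm1/PlaneOddXZ. Qed.

Lemma u_last_comm_star mu : qcomm 1 (u_last theta) (star (u_gen theta mu)).
Proof. exact: qcomm1_star star_u_last (u_last_comm mu). Qed.

Lemma u_sphere :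
  \sum_mu u_gen theta mu * star (u_gen theta mu)
  + u_last theta * u_last theta = 1.
Proof. exact: sq_pi_sphere_even. Qed.

Lemma v_sphere : \sum_mu v_gen theta mu * star (v_gen theta mu) = 1.
Proof. exact: sq_pi_sphere_odd. Qed.

End PlaneRelations.

(** * The spin representation and its grading *)

Section SpinMatrices.
Variables (R : realType) (n : nat) (theta : 'M[R]_n).
Variable rho : {rmorphism cliff theta -> spin_mx R n}.
Hypothesis theta_skew : theta^T = - theta.
Hypothesis rhoP : spin_identification rho.
Local Notation C := R[i].
Local Notation q := (2 ^ n.-1)%N.
Local Notation cl := (cliff theta).

(** Gives the values of [rho] a matrix type, in place of the ring [spin_mx]. *)
Definition spin (a : cl) : 'M[C]_(q + q) := rho a.

Lemma spinD a b : spin (a + b) = spin a + spin b.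
Proof. exact: (rmorphD rho). Qed.

Lemma spinN a : spin (- a) = - spin a.
Proof. exact: (rmorphN rho). Qed.

Lemma spin0 : spin 0 = 0.
Proof. exact: (rmorph0 rho). Qed.

Lemma spin1 : spin 1 = 1%:M.
Proof. exact: (rmorph1 rho). Qed.

Lemma spinM a b : spin (a * b) = spin a *m spin b.
Proof. exact: (rmorphM rho). Qed.

Lemma spinZ c a : spin (scal c * a) = c *: spin a.
Proof. by rewrite spinM [spin (scal c)](spin_scal rhoP) mul_scalar_mx. Qed.

Lemma spin_adj a : (map_mx Num.conj (spin a))^T = spin (star a).
Proof. exact: (esym (spin_star rhoP a)). Qed.

Lemma spin_gammaE : spin (cliff_gamma theta) = block_mx 1%:M 0 0 (- 1%:M).
Proof. exact: spin_gamma rhoP. Qed.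

Definition spin_ur (l : 'I_n * bool) := ursubmx (spin (gen theta (Some l))).
Definition spin_dl (l : 'I_n * bool) := dlsubmx (spin (gen theta (Some l))).

(** Anticommuting with diag(1, -1) kills the diagonal blocks of [Gam]; those of its adjoint vanish
    by conjugate transposition. *)
Lemma spin_genE l :
  spin (gen theta (Some l)) = block_mx 0 (spin_ur l) (spin_dl l) 0.
Proof.
suff antidiag mu :
    let M := spin (Gam theta mu) in ulsubmx M = 0 /\ drsubmx M = 0.
  rewrite -[LHS]submxK; case: l => mu [] /=; last first.
    by have [-> ->] := antidiag mu.
  have [ul0 dr0] := antidiag mu.
  congr block_mx; rewrite -spin_adj.
    by rewrite -trmx_ulsub -map_ulsubmx ul0 map_mx0 trmx0.
  by rewrite -trmx_drsub -map_drsubmx dr0 map_mx0 trmx0.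
move=> M; have /qcommN1P/(congr1 spin) := Gam_gamma theta_skew mu.
rewrite spinN !spinM spin_gammaE -/M -[M]submxK !mulmx_block.
rewrite !mulmx1 !mul1mx !mulmx0 !mul0mx !mulmxN !mulNmx !mulmx1 !mul1mx.
rewrite !addr0 !add0r opp_block_mx opprK => /eq_block_mx[ul _ _ dr].
rewrite submxK; split; first exact: eq_oppmx ul.
exact: eq_oppmx (oppr_inj dr).
Qed.

Lemma tr_spin_word (w : seq (letter n)) :
  odd (size w) -> (size w <= n.*2)%N ->
  \tr (spin (\prod_(l <- w) gen theta l)) = 0.
Proof.
apply: (tau_word theta_skew (tau := fun a => \tr (spin a))) => [a b|c a|a b].
- by rewrite spinD mxtraceD.
- by rewrite spinZ mxtraceZ.
- by rewrite !spinM mxtrace_mulC.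
Qed.

(** * The element X and its square *)

Section PlaneElement.
Variables (A : starAlgType C) (z : 'I_n -> A).
Hypothesis z_comm : plane_comm theta z.

(** [true] marks [Gs] in [gen] but [z] here, so that [Gs] is paired with [z] and [G] with its
    adjoint. *)
Definition coord (l : 'I_n * bool) : A := if l.2 then z l.1 else star (z l.1).

Definition dual (l : 'I_n * bool) := (l.1, ~~ l.2).

Lemma dualK : involutive dual.
Proof. by case=> mu b; rewrite /dual /= negbK. Qed.

Definition vect_mx : 'M[A]_(q + q) :=
  \sum_l (spin (gen theta (Some l)) *t coord l).

(** The same phase enters [gen_anticomm] and [coord_comm], which is why X squares as in the
    undeformed case. *)
Definition letter_phase (l l' : 'I_n * bool) : C :=
  if l.2 (+) l'.2 then phase theta l.1 l'.1 else phase theta l'.1 l.1.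

Lemma gen_anticomm l l' :
  gen theta (Some l) * gen theta (Some l')
  + scal (letter_phase l l') * (gen theta (Some l') * gen theta (Some l))
  = (l' == dual l)%:R.
Proof.
case: l l' => [mu b] [nu b']; rewrite /letter_phase /dual xpair_eqE /=.
have GG := GamGam theta; have GsGs := GamsGams theta.
have GsG := GamsGam theta.
rewrite [nu == mu]eq_sym; case: b b' => [] [] /=; rewrite ?andbT ?andbF.
- by rewrite GsGs scalN mulNr addNr.
- by rewrite GsG.
- have [<-|mn] := eqVneq mu nu.
    rewrite addrC (phase_id theta_skew) scal1 mul1r.
    by rewrite (Gam_anticomm theta_skew).
  by rewrite (GamGams_ne theta_skew mn) scalN mulNr addNr.
- by rewrite GG scalN mulNr addNr.
Qed.

Lemma coord_comm l l' :
  coord l' * coord l = scal (letter_phase l l') * (coord l * coord l').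
Proof.
case: l l' => [mu b] [nu b']; rewrite /letter_phase /coord /=.
case: b b' => [] [] /=.
- exact: plane_zz.
- exact: plane_zbz.
- by apply: (qcommC (phaseV theta_skew nu mu)); apply: plane_zbz.
- exact: plane_zbzb.
Qed.

Lemma vect_mx_sq : vect_mx *m vect_mx = (\sum_mu z mu * star (z mu))%:M.
Proof.
pose T l l' := (spin (gen theta (Some l) * gen theta (Some l')))
               *t (coord l * coord l').
have vE : vect_mx *m vect_mx = \sum_l \sum_l' T l l'.
  rewrite mulmx_suml; apply: eq_bigr => l _.
  by rewrite mulmx_sumr; apply: eq_bigr => l' _; rewrite mx_tensM -spinM.
(* Reordering the coordinates produces the phase of the Clifford anticommutator, which survives for
   dual letters only. *)
have TT l l' : T l l' + T l' l =
    if l' == dual l then (coord l * coord l')%:M else 0.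
  rewrite /T (coord_comm l l') -mx_tensZl -mx_tensDl -spinZ -spinD gen_anticomm.
  case: ifP => _; first by rewrite spin1 mx_tens1.
  by rewrite mulr0n spin0 mx_tens0l.
have v2 : vect_mx *m vect_mx + vect_mx *m vect_mx
        = (\sum_mu (z mu * star (z mu) + z mu * star (z mu)))%:M.
  (* Exchanging the sums in one copy of the square pairs [T l l'] with [T l' l]. *)
  rewrite {2}vE exchange_big vE -big_split /=.
  under eq_bigr => l _.
    rewrite -big_split /=; under eq_bigr do rewrite TT.
    rewrite -big_mkcond big_pred1_eq; over.
  rewrite -(raddf_sum (@scalar_mx A (q + q))).
  congr (_%:M); rewrite big_pair_bool; apply: eq_bigr => mu _.
  rewrite /coord /=; congr (_ + _).
  (* [z mu] commutes with its adjoint, the diagonal phase being 1. *)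
  have := plane_zbz z_comm mu mu.
  by rewrite /qcomm (phase_id theta_skew) scal1 mul1r.
apply/matrixP => i j; have /matrixP/(_ i j) := v2.
rewrite big_split raddfD !mxE => vij.
by rewrite -[LHS]scal_half_double vij scal_half_double.
Qed.

(** The adjoint exchanges the terms of [l] and [dual l]. *)
Lemma mxstar_vect : mxstar vect_mx = vect_mx.
Proof.
rewrite mxstar_sum [RHS](reindex_inj (inv_inj dualK)); apply: eq_bigr => l _.
rewrite mxstar_tens spin_adj; congr (spin _ *t _).
  by case: l => mu [] //=; rewrite starK.
by case: l => mu [] //=; rewrite /coord /= starK.
Qed.

Lemma vect_mxE : vect_mx = \sum_mu (spin_GamS rho mu *t z mu
                                    + spin_Gam rho mu *t star (z mu)).
Proof. exact: big_pair_bool. Qed.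

End PlaneElement.

(** * The even sphere: projection and Chern character *)

Local Notation gamma := (cliff_gamma theta).
Local Notation u := (u_gen theta).
Local Notation u0 := (u_last theta).

Definition even_coord (l : letter n) : sphere_even theta :=
  if l is Some l' then coord u l' else u0.

Definition even_mx : 'M[sphere_even theta]_(q + q) :=
  \sum_l (spin (gen theta l) *t even_coord l).

Lemma even_mxE : even_mx = vect_mx u + (spin gamma *t u0).
Proof. by rewrite /even_mx big_option addrC. Qed.

Lemma even_projectionE :
  even_projection rho = scal 2^-1 *: (1%:M + even_mx).
Proof. by rewrite even_mxE addrA vect_mxE. Qed.

Lemma spin_gamma_adj : (map_mx Num.conj (spin gamma))^T = spin gamma.
Proof.
rewrite spin_gammaE map_block_mx tr_block_mx map_mx1 !map_mx0 map_mxN map_mx1.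
by rewrite !trmx0 trmx1 linearN /= trmx1.
Qed.

Lemma mxstar_even : mxstar even_mx = even_mx.
Proof.
by rewrite even_mxE mxstarD mxstar_vect mxstar_tens spin_gamma_adj star_u_last.
Qed.

Lemma spin_gamma_sq : spin gamma *m spin gamma = 1%:M.
Proof.
rewrite spin_gammaE mulmx_block !mulmx0 !mul0mx mulmx1 mulNmx mulmxN mul1mx.
by rewrite opprK !addr0 !add0r -scalar_mx_block.
Qed.

Lemma spin_gamma_gen l :
  spin gamma *m spin (gen theta (Some l)) =
  - (spin (gen theta (Some l)) *m spin gamma).
Proof.
rewrite spin_gammaE spin_genE !mulmx_block opp_block_mx.
rewrite !mulmx0 !mul0mx !mulNmx !mulmxN !mul1mx !mulmx1 ?mul0mx ?mulmx0.
by rewrite !addr0 !add0r !oppr0 opprK.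
Qed.

Lemma u_last_coord l : u0 * coord u l = coord u l * u0.
Proof.
case: l => mu [] /=; apply/qcomm1P; [exact: u_last_comm|].
exact: u_last_comm_star.
Qed.

(** The cross terms cancel: gamma anticommutes with the generators while [u0] commutes with the
    coordinates. *)
Lemma even_mx_sq : even_mx *m even_mx = 1%:M.
Proof.
have anti : (spin gamma *t u0) *m vect_mx u =
    - (vect_mx u *m (spin gamma *t u0)).
  rewrite mulmx_sumr mulmx_suml -sumrN; apply: eq_bigr => l _.
  by rewrite !mx_tensM spin_gamma_gen mx_tensNl u_last_coord.
rewrite even_mxE mulmxDl !mulmxDr anti (vect_mx_sq (u_gen_comm theta)).
rewrite addrA addrK mx_tensM spin_gamma_sq mx_tens1 -raddfD.
by congr (_%:M); apply: u_sphere.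
Qed.

(** For F = [even_mx] with F^2 = 1, one has (1 + F)^2 = 2 (1 + F). *)
Lemma even_projection_idem :
  even_projection rho *m even_projection rho = even_projection rho.
Proof.
rewrite even_projectionE scalZ_mxM mulmxDl !mulmxDr even_mx_sq mul1mx mulmx1.
rewrite mul1mx [even_mx + 1%:M]addrC; apply/matrixP => i j; rewrite !mxE.
by rewrite scalM -!mulrA scal_half_double.
Qed.

Lemma mxstar_even_projection :
  mxstar (even_projection rho) = even_projection rho.
Proof.
rewrite even_projectionE mxstarZ mxstarD mxstar1 mxstar_even.
by rewrite fmorphV rmorph_nat.
Qed.

Lemma tr_word_even m (p : seq (letter n)) : size p = m.*2.+1 -> (m < n)%N ->
  \tr (word_mx (fun=> fun l => 2^-1 *: spin (gen theta l)) p) = 0.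
Proof.
move=> sz mn.
(* [word_mx] multiplies from the end of the list, hence [rev]; each letter brings a factor 1/2. *)
have -> w : word_mx (fun=> fun l => 2^-1 *: spin (gen theta l)) w =
    2^-1 ^+ size w *: spin (\prod_(l <- rev w) gen theta l).
  elim: w => [|l w IHw]; first by rewrite big_nil scale1r spin1.
  rewrite /= IHw rev_cons big_rcons /= spinM exprSr.
  by rewrite -scalemxAl -scalemxAr scalerA.
rewrite mxtraceZ tr_spin_word ?mulr0 // size_rev sz /= ?odd_double //.
by rewrite ltn_double.
Qed.

Lemma ch_even_projection m : (m < n)%N -> ch m (even_projection rho) = 0.
Proof.
move=> mn.
have sumE : \sum_l ((2^-1 *: spin (gen theta l)) *t even_coord l) =
    scal 2^-1 *: even_mx.
  by rewrite scaler_sumr; apply: eq_bigr => l _; rewrite mx_tensZ.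
(* Every factor becomes half of [even_mx]: at position 0 because [ch] subtracts 1/2 there, elsewhere
   because scalars vanish modulo C 1. *)
rewrite /ch (@eq_cyclic_chain _ _ _ _ _ (fun=> \sum_l
    ((2^-1 *: spin (gen theta l)) *t even_coord l))); last 2 first.
- by rewrite sumE even_projectionE scalerDr scalemx1 addrAC subrr add0r.
- move=> j a b; rewrite sumE even_projectionE scalerDr scalemx1.
  exact: lq_pi_add_scalar.
rewrite cyclic_chain_words big_seq big1 // => p p_m.
rewrite (@tr_word_even m) ?scale0r //.
by apply/eqP; have /allP := size_chain_terms even_coord m.*2; apply.
Qed.

(** * The odd sphere: unitary and Chern character *)

Local Notation v := (v_gen theta).

Lemma odd_unitaryE :
  odd_unitary rho = \sum_l (spin_ur l *t coord v l).
Proof. exact/esym/big_pair_bool. Qed.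

Lemma vect_mx_antidiag (A : starAlgType C) (z : 'I_n -> A) :
  vect_mx z = block_mx 0 (\sum_l (spin_ur l *t coord z l))
                         (\sum_l (spin_dl l *t coord z l)) 0.
Proof.
rewrite -sum_antidiag; apply: eq_bigr => l _.
by rewrite spin_genE block_mx_tens !mx_tens0l.
Qed.

(** Self-adjointness of X makes its two off-diagonal blocks adjoint to each other. *)
Lemma mxstar_odd_unitary :
  mxstar (odd_unitary rho) = \sum_l (spin_dl l *t coord v l).
Proof.
have := mxstar_vect v; rewrite vect_mx_antidiag mxstar_block -odd_unitaryE.
by case/eq_block_mx.
Qed.

(** On the sphere X squares to 1, and the two diagonal blocks of this identity are the two unitarity
    equations. *)
Lemma odd_unitary_block :
  let U := odd_unitary rho in
  block_mx (U *m mxstar U) 0 0 (mxstar U *m U) = 1%:M.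
Proof.
rewrite /= -(v_sphere theta) -(vect_mx_sq (v_gen_comm theta)).
rewrite vect_mx_antidiag -odd_unitaryE -mxstar_odd_unitary mulmx_block.
by rewrite !mulmx0 !mul0mx !addr0 !add0r.
Qed.

Lemma odd_unitary_mulr : odd_unitary rho *m mxstar (odd_unitary rho) = 1%:M.
Proof.
by have := odd_unitary_block; rewrite scalar_mx_block => /eq_block_mx[].
Qed.

Lemma odd_unitary_mull : mxstar (odd_unitary rho) *m odd_unitary rho = 1%:M.
Proof.
by have := odd_unitary_block; rewrite scalar_mx_block => /eq_block_mx[].
Qed.

(** Coefficients of the alternating factors; [b] tells whether they start with [mxstar U]. *)
Definition alt_mx (b : bool) (j : nat) :=
  if odd j (+) b then spin_dl else spin_ur.

(** Each antidiagonal factor switches halves, so along a row of blocks [spin_ur] and [spin_dl]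
    alternate. *)
Lemma spin_word_block (w : seq ('I_n * bool)) :
  spin (\prod_(l <- rev w) gen theta (Some l)) =
  let M := word_mx (alt_mx false) w in let N := word_mx (alt_mx true) w in
  if odd (size w) then block_mx 0 M N 0 else block_mx M 0 0 N.
Proof.
elim: w => [|l w IHw]; first by rewrite big_nil spin1 /= -scalar_mx_block.
rewrite rev_cons big_rcons spinM IHw /= /alt_mx spin_genE.
by case: (odd (size w)); rewrite mulmx_block !mulmx0 !mul0mx !addr0 !add0r.
Qed.

(** As gamma is 1 and -1 on the two halves, the difference of the traces is the trace of gamma times
    the word, of odd length 2k + 3 < 2n + 1. *)
Lemma tr_word_odd k (w : seq ('I_n * bool)) :
  size w = k.*2.+2 -> (k.+1 < n)%N ->
  \tr (word_mx (alt_mx false) w) = \tr (word_mx (alt_mx true) w).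
Proof.
move=> sz kn; apply/eqP; rewrite -subr_eq0 -raddfN.
have := @tr_spin_word (None :: map Some (rev w)).
rewrite /= size_map size_rev sz big_cons big_map /= spinM spin_word_block sz /=.
rewrite odd_double /= spin_gammaE mulmx_block !mulmx0 !mul0mx !addr0 !add0r.
rewrite mxtrace_block mul1mx mulNmx mul1mx => -> //.
by rewrite -doubleS ltn_double.
Qed.

Lemma ch_half_odd_unitary k : (k.+1 < n)%N -> ch_half k (odd_unitary rho) = 0.
Proof.
move=> kn.
set U := odd_unitary rho.
have altE b j : (if odd j (+) b then mxstar U else U) =
    \sum_l (alt_mx b j l *t coord v l).
  by rewrite /alt_mx /U mxstar_odd_unitary odd_unitaryE; case: (_ (+) b).
have UE : cyclic_chain k.*2.+1 (fun j => if odd j then mxstar U else U) =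
    \sum_(p <- chain_terms (coord v) k.*2.+1)
      \tr (word_mx (alt_mx false) p.1) *: p.2.
  rewrite -cyclic_chain_words.
  by apply: eq_cyclic_chain => [|j a b]; rewrite -altE addbF.
have UsE : cyclic_chain k.*2.+1 (fun j => if odd j then U else mxstar U) =
    \sum_(p <- chain_terms (coord v) k.*2.+1)
      \tr (word_mx (alt_mx true) p.1) *: p.2.
  rewrite -cyclic_chain_words.
  by apply: eq_cyclic_chain => [|j a b]; rewrite -altE; case: odd.
(* Both sums run over the same chains, so equality of the traces suffices. *)
rewrite /ch_half UE UsE; apply/eqP; rewrite subr_eq0; apply/eqP.
apply: eq_big_seq => p p_k; rewrite (@tr_word_odd k) //.
by apply/eqP; have /allP := size_chain_terms (coord v) k.*2.+1; apply.
Qed.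

End SpinMatrices.

Theorem theorem4 (R : realType) (n : nat) (theta : 'M[R]_n)
    (rho : {rmorphism cliff theta -> spin_mx R n}) :
  (2 <= n)%N -> theta^T = - theta -> spin_identification rho ->
  (let e := even_projection rho in
   [/\ e *m e = e, mxstar e = e &
       forall m : nat, (0 <= m <= n - 1)%N -> ch m e = 0])
  /\
  (let U := odd_unitary rho in
   [/\ U *m mxstar U = 1%:M, mxstar U *m U = 1%:M &
       (* ch_half (m - 1) is the component of degree m - 1/2 *)
       forall m : nat, (1 <= m <= n - 1)%N -> ch_half (m - 1) U = 0]).
Proof.
move=> n_ge2 theta_skew rhoP.
have predn_lt m : (m <= n - 1)%N -> (m < n)%N.
  by rewrite subn1 => /leq_ltn_trans; apply; rewrite ltn_predL ltnW.
have chU m : (1 <= m <= n - 1)%N -> ch_half (m - 1) (odd_unitary rho) = 0.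
  move=> /andP[m_gt0 /predn_lt m_lt]; apply: ch_half_odd_unitary => //.
  (* [m] is positive, so the truncated [m - 1] has successor [m]. *)
  by rewrite subn1 prednK.
split=> [e|U]; split.
- exact: even_projection_idem.
- exact: mxstar_even_projection.
- by move=> m /predn_lt; apply: ch_even_projection.
- exact: odd_unitary_mulr.
- exact: odd_unitary_mull.
- exact: chU.
Qed.
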